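(* Fix $\eta\in(0,1)$. There exist constants $C,c>0$ depending only on $\eta$ and, for each $\varepsilon>0$, a constant $C(\varepsilon)$ depending only on $\varepsilon$ and $\eta$, such that: if $m=n$, $M$ is a positive semi-definite $n\times n$ matrix with entries bounded by $1$ in absolute value, and $p\in[0,1]$ satisfies $p\ge n^{-1+\varepsilon}$ for some $\varepsilon>0$, then the USVT estimator $\hat M$ with tuning parameter $\eta$ satisfies $$\operatorname{MSE}(\hat M)\le\frac{C}{\sqrt{np}}+C(\varepsilon)e^{-cnp}.$$
   Context: Positive semi-definite matrices are real symmetric. The data come from a data matrix $X$ with mean $M$ under either of the following models (order $n\times n$). Asymmetric model (with $m=n$): $X$ is a random $n\times n$ matrix with independent entries, $\mathbb{E}(x_{ij})=m_{ij}$ and $|x_{ij}|\le 1$ almost surely ($X=M$ allowed); each entry of $X$ is observed with probability $p$ and unobserved with probability $1-p$, independently of everything else. Symmetric model: $X$ is symmetric, its entries on and above the diagonal are independent with $\mathbb{E}(x_{ij})=m_{ij}$ and $|x_{ij}|\le1$ almost surely; each entry on and above the diagonal is observed with probability $p$, independently of everything else, and for $i<j$ the entry $(j,i)$ is observed if and only if $(i,j)$ is. $\operatorname{MSE}(\hat M):=\mathbb{E}\big[\frac1{n^2}\sum_{i,j=1}^n(\hat m_{ij}-m_{ij})^2\big]$. USVT estimator with tuning parameter $\eta\in(0,1)$: let $y_{ij}=x_{ij}$ if $x_{ij}$ is observed and $y_{ij}=0$ otherwise, $Y=(y_{ij})$, with singular value decomposition $Y=\sum_{i=1}^n s_iu_iv_i^T$.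 Let $\hat p$ be the proportion of observed entries of $X$ (in the symmetric model: among those on and above the diagonal). Let $S:=\{i: s_i\ge(2+\eta)\sqrt{n\hat p}\}$ and $W:=\frac1{\hat p}\sum_{i\in S}s_iu_iv_i^T$ (if $\hat p=0$, put $W:=0$). Finally $\hat m_{ij}$ is the truncation of $w_{ij}$ to $[-1,1]$ ($\hat m_{ij}=w_{ij}$ if $|w_{ij}|\le1$, $1$ if $w_{ij}>1$, $-1$ if $w_{ij}<-1$). *)

(* Defs.v *)
From HB Require Import structures.
From mathcomp Require Import all_boot all_order all_algebra.
From mathcomp Require Import all_classical all_reals all_analysis.

Set Implicit Arguments.
Unset Strict Implicit.
Unset Printing Implicit Defensive.

Import Order.TTheory GRing.Theory Num.Theory.
Import numFieldNormedType.Exports.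

Local Open Scope classical_set_scope.
Local Open Scope ring_scope.

Definition psdmx (R : realType) (n : nat) (M : 'M[R]_n) : Prop :=
  M \is symmetricmx /\ forall z : 'cV[R]_n, 0 <= (z^T *m M *m z) 0 0.

Definition indep_on (d : measure_display) (T : measurableType d)
    (R : realType) (P : probability T R) (J : finType) (A : {set J})
    (F : J -> set_system T) : Prop :=
  forall (B : {set J}) (E : J -> set T),
    B \subset A -> (forall j, j \in B -> F j (E j)) ->
    P (\bigcap_(j in [set` B]) E j) = (\prod_(j in B) P (E j))%E.

Inductive model := Asymmetric | Symmetric.

(* The positions (i, j) whose values and observation statuses are drawn
   independently. *)
Definition free_entries (mo : model) (n : nat) : {set 'I_n * 'I_n} :=
  match mo with
  | Asymmetric => [set: 'I_n * 'I_n]%SET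
  | Symmetric => [set ij : 'I_n * 'I_n | (ij.1 <= ij.2)%N]%SET
  end.

Section Model.
Context (d : measure_display) (T : measurableType d) (R : realType).
Context (P : probability T R) (n : nat).
Implicit Types (X : 'I_n -> 'I_n -> {RV P >-> R}).
Implicit Types (O : 'I_n -> 'I_n -> {RV P >-> bool}).

(* inl ij is the value of entry ij, inr ij is its observation status. *)
Definition entry_sigma X O (k : 'I_n * 'I_n + 'I_n * 'I_n) : set_system T :=
  match k with
  | inl ij => preimage_set_system setT (X ij.1 ij.2) measurable
  | inr ij => preimage_set_system setT (O ij.1 ij.2) measurable
  end.

(* X i j is the (i, j) entry of the data matrix; O i j w holds when that entry
   is observed at the outcome w. *)
Record data_model (mo : model) (M : 'M[R]_n) (p : R) X O : Prop := DataModel {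
  data_mean : forall i j, 'E_P[X i j]%E = (M i j)%:E;
  data_bounded : forall i j, {ae P, forall w, `|X i j w| <= 1};
  data_observed : forall i j, P [set w | O i j w] = p%:E;
  data_indep : indep_on P
    [set k | match k with inl ij | inr ij => ij \in free_entries mo n end]%SET
    (entry_sigma X O);
  data_sym : mo = Symmetric ->
    forall i j w, X i j w = X j i w /\ O i j w = O j i w
}.

Definition observed_mx X O (w : T) : 'M[R]_n :=
  \matrix_(i, j) if O i j w then X i j w else 0.

Definition phat (mo : model) O (w : T) : R :=
  #|[set ij in free_entries mo n | O ij.1 ij.2 w]%SET|%:R
    / #|free_entries mo n|%:R.

Definition MSE (M : 'M[R]_n) (Mhat : T -> 'M[R]_n) : \bar R :=
  'E_P[(fun w =>
    (n%:R ^+ 2)^-1 * \sum_i \sum_j (Mhat w i j - M i j) ^+ 2)%R]%E.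

End Model.

(* The singular vectors u_i and v_i are the columns of U and V. The singular
   values are not required to be sorted. *)
Record is_svd (R : realType) (n : nat) (Y : 'M[R]_n) (s : 'I_n -> R)
    (U V : 'M[R]_n) : Prop := IsSvd {
  svd_ge0 : forall i, 0 <= s i;
  svd_left : U^T *m U = 1%:M;
  svd_right : V^T *m V = 1%:M;
  svd_eq : Y = \sum_i s i *: (col i U *m (col i V)^T)
}.

Definition clip (R : realType) (x : R) : R :=
  if 1 < x then 1 else if x < -1 then -1 else x.

(* The result depends only on ph, eta and the matrix of which (s, U, V) is a
   singular value decomposition, since equal singular values are kept or
   discarded together. *)
Definition usvt (R : realType) (n : nat) (eta ph : R) (s : 'I_n -> R)
    (U V : 'M[R]_n) : 'M[R]_n :=
  let S := [set i | (2 + eta) * Num.sqrt (n%:R * ph) <= s i]%SET in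
  let W := if ph == 0 then 0
           else ph^-1 *: \sum_(i in S) s i *: (col i U *m (col i V)^T) in
  map_mx (@clip R) W.

(* Main.v *)
(* The noise matrix Y - pM has spectral norm at most (2 + eta/2) sqrt(np) up to
   probability O(1 / sqrt(np)), once n is large in terms of eps; the term
   C(eps) e^(-cnp) only has to absorb the finitely many remaining n.

   Given this bound, let |Y - B| <= tau < t with B = pM positive semidefinite,
   and let Yh keep the singular values of Y that are at least t.  Every kept
   triple has u^T B v >= s - tau, while sum_i u_i^T B v_i <= tr B, so that at most
   tr B / (t - tau) values are kept.  Expanding
   |B - Yh|_F^2 = <B - Yh, B> - <B - Yh, Yh> gives a bound of order t tr B, and
   tr B <= pn.

   For the norm, E tr (Y - pM)^q, with q a power of two of order log n, is
   expanded over walks in the index graph; an edge used exactly once kills the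
   expectation.  Call an edge that discovers a new vertex open until it is used
   again: a step opens an edge (total weight np), closes an open edge, or does
   neither.  The closing step is determined unless several open edges meet at
   the current vertex, and a potential shows that undetermined closing steps
   are at most as many as the steps of the third kind.  Giving each open edge
   the weight 1 / sqrt(np), and the potential the base theta = (np)^(1/4), each
   step costs at most 2 sqrt(np) + 3 q theta.  Markov's inequality then yields
   the norm bound, with no concentration inequality. *)
Require Import Defs.
From mathcomp Require Import all_boot all_order all_algebra.
From mathcomp Require Import all_classical all_reals all_analysis.
From mathcomp Require Import measurable_realfun ring lra zify.

Set Implicit Arguments.
Unset Strict Implicit.
Unset Printing Implicit Defensive.

Import Order.TTheory GRing.Theory Num.Theory.
Import numFieldNormedType.Exports.

Local Open Scope ring_scope.

(** * Thresholding a singular value decomposition *)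

Section BilinearForms.
Context (R : realFieldType) (n : nat).
Implicit Types (A B D E F : 'M[R]_n) (u v z : 'cV[R]_n).

Definition bform A u v : R := (u^T *m A *m v) 0 0.

Definition sqnorm u : R := (u^T *m u) 0 0.

Definition mxinner A B : R := \tr (A^T *m B).

Definition sqfrob A : R := \sum_i \sum_j A i j ^+ 2.

(** Rescaling [u] by a and [v] by 1/a and optimising over a shows that, for [t >= 0], this says that
    the spectral norm of [A] is at most [t]. Squared norms avoid square roots, which a
    [realFieldType] may lack. *)
Definition form_le A (t : R) : Prop :=
  forall u v, bform A u v <= t / 2 * (sqnorm u + sqnorm v).

Lemma bformDl A u u' v : bform A (u + u') v = bform A u v + bform A u' v.
Proof. by rewrite /bform linearD /= !mulmxDl mxE. Qed.

Lemma bformDr A u v v' : bform A u (v + v') = bform A u v + bform A u v'.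
Proof. by rewrite /bform mulmxDr mxE. Qed.

Lemma bformZl A a u v : bform A (a *: u) v = a * bform A u v.
Proof. by rewrite /bform linearZ /= -!scalemxAl mxE. Qed.

Lemma bformZr A a u v : bform A u (a *: v) = a * bform A u v.
Proof. by rewrite /bform -scalemxAr mxE. Qed.

Lemma bformD A B u v : bform (A + B) u v = bform A u v + bform B u v.
Proof. by rewrite /bform mulmxDr mulmxDl mxE. Qed.

Lemma bformZ a A u v : bform (a *: A) u v = a * bform A u v.
Proof. by rewrite /bform -scalemxAr -scalemxAl mxE. Qed.

Lemma bform_sum I (r : seq I) (P : pred I) (G : I -> 'M[R]_n) u v :
  bform (\sum_(i <- r | P i) G i) u v = \sum_(i <- r | P i) bform (G i) u v.
Proof.
apply: (big_ind2 (fun A x => bform A u v = x)) => //.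
- by rewrite /bform mulmx0 mul0mx mxE.
- by move=> A x B y <- <-; rewrite bformD.
Qed.

Lemma bformC A u v : A^T = A -> bform A u v = bform A v u.
Proof.
move=> AT; rewrite /bform.
have -> : u^T *m A *m v = (v^T *m A *m u)^T.
  by rewrite !trmx_mul trmxK AT mulmxA.
by rewrite mxE.
Qed.

Lemma bform_outer (x y u v : 'cV[R]_n) :
  bform (x *m y^T) u v = (u^T *m x) 0 0 * (y^T *m v) 0 0.
Proof.
rewrite /bform mulmxA -(mulmxA (u^T *m x)).
by rewrite mxE big_ord_recl big_ord0 addr0.
Qed.

Lemma bform_delta A i j : bform A (delta_mx i 0) (delta_mx j 0) = A i j.
Proof. by rewrite /bform trmx_delta -rowE -colE !mxE. Qed.

Lemma sqnormE u : sqnorm u = \sum_i u i 0 ^+ 2.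
Proof. by rewrite /sqnorm mxE; apply: eq_bigr => i _; rewrite mxE expr2. Qed.

Lemma mxinnerE A B : mxinner A B = \sum_i \sum_j A i j * B i j.
Proof.
rewrite /mxinner /mxtrace exchange_big /=; apply: eq_bigr => j _.
by rewrite mxE; apply: eq_bigr => i _; rewrite mxE.
Qed.

Lemma mxinnerC A B : mxinner A B = mxinner B A.
Proof.
rewrite !mxinnerE; apply: eq_bigr => i _; apply: eq_bigr => j _.
by rewrite mulrC.
Qed.

Lemma sqfrob_inner A : sqfrob A = mxinner A A.
Proof. by rewrite mxinnerE. Qed.

Lemma mxinnerBl A B D : mxinner (A - B) D = mxinner A D - mxinner B D.
Proof. by rewrite /mxinner linearB /= mulmxBl linearB. Qed.

Lemma mxinnerZr a A B : mxinner A (a *: B) = a * mxinner A B.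
Proof. by rewrite /mxinner -scalemxAr linearZ. Qed.

Lemma mxinner_sumr A I (r : seq I) (P : pred I) (G : I -> 'M[R]_n) :
  mxinner A (\sum_(i <- r | P i) G i) = \sum_(i <- r | P i) mxinner A (G i).
Proof. by rewrite /mxinner mulmx_sumr linear_sum. Qed.

Lemma mxinner_outer A u v : mxinner A (u *m v^T) = bform A u v.
Proof.
rewrite /mxinner /bform mulmxA mxtrace_mulC /mxtrace big_ord1.
have -> : v^T *m (A^T *m u) = (u^T *m A *m v)^T.
  by rewrite !trmx_mul !trmxK.
by rewrite mxE.
Qed.

Lemma form_leD A B s t :
  form_le A s -> form_le B t -> form_le (A + B) (s + t).
Proof.
move=> As Bt u v; rewrite bformD (le_trans (lerD (As u v) (Bt u v))) //.
by rewrite -mulrDl -mulrDl.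
Qed.

Lemma form_leN A s : form_le A s -> form_le (- A) s.
Proof.
move=> As u v; rewrite -scaleN1r bformZ -bformZl scaleN1r.
rewrite (le_trans (As _ _)) //.
suff -> : sqnorm (- u) = sqnorm u by [].
by rewrite !sqnormE; apply: eq_bigr => i _; rewrite mxE sqrrN.
Qed.

Definition psform B : Prop := B^T = B /\ forall z, 0 <= bform B z z.

(** Positivity at e_i + e_j and at e_i - e_j gives 2 B_ij >= 0 and -2 B_ij >= 0. *)
Lemma psform_diag0 B : psform B -> (forall i, B i i = 0) -> B = 0.
Proof.
move=> [BT Bge0] B0; apply/matrixP => i j; rewrite mxE.
have := Bge0 (delta_mx i 0 + delta_mx j 0).
have := Bge0 (delta_mx i 0 + (-1) *: delta_mx j 0).
rewrite !(bformDl, bformDr, bformZl, bformZr) !bform_delta !B0.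
have -> : B j i = B i j by rewrite -{1}BT mxE.
lra.
Qed.

Lemma psform_diag B i : psform B -> 0 <= B i i.
Proof. by move=> [_ /(_ (delta_mx i 0))]; rewrite bform_delta. Qed.

Lemma psform_bform_le B u v : psform B ->
  bform B u v <= (bform B u u + bform B v v) / 2.
Proof.
move=> [BT /(_ (u + (-1) *: v))].
rewrite !(bformDl, bformDr, bformZl, bformZr) (bformC v u BT).
lra.
Qed.

(* Symmetric Gaussian elimination writes B as a nonnegative combination of
   squares x x^T, on which the claim is the hypothesis on F. *)
Lemma psform_mxtrace_ge0 F B : psform B -> (forall z, 0 <= bform F z z) ->
  0 <= mxinner F B.
Proof.
move=> psB Fge0.
(* Induction on the number of nonzero diagonal entries: an elimination kills one and creates
   none. *)
have [k] := ubnP #|[set i | B i i != 0]|.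
elim: k B psB => // k IHk B psB; rewrite ltnS => Bk.
have [i /= Bi0|B0] := pickP [pred i | B i i != 0]; last first.
  rewrite (psform_diag0 psB) ?/mxinner ?mulmx0 ?mxtrace0 // => i.
  by apply/eqP; have := B0 i; rewrite /= => /negbFE.
have Bi_gt0 : 0 < B i i by rewrite lt_def Bi0 psform_diag.
have [BT Bge0] := psB.
pose x := col i B; pose B' := B - (B i i)^-1 *: (x *m x^T).
have xz z : (x^T *m z) 0 0 = bform B z (delta_mx i 0).
  by rewrite bformC // /bform /x colE trmx_mul BT.
have zx z : (z^T *m x) 0 0 = bform B z (delta_mx i 0).
  by rewrite /bform /x colE mulmxA.
have psB' : psform B'.
  split; first by rewrite /B' linearB linearZ /= trmx_mul trmxK BT.
  move=> z; rewrite /B' -scaleNr bformD bformZ bform_outer xz zx.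
  set b := bform B z (delta_mx i 0).
  (* The form of [B'] at z is the form of [B] at this vector, the minimiser on the line z + R
     e_i. *)
  have := Bge0 (z - (b / B i i) *: delta_mx i 0).
  rewrite -scaleNr !(bformDl, bformDr, bformZl, bformZr) (bformC _ z BT).
  rewrite bform_delta -/b.
  by congr (_ <= _); field.
have -> : mxinner F B = mxinner F B' + (B i i)^-1 * bform F x x.
  rewrite [mxinner F B']mxinnerC mxinnerBl !(mxinnerC _ F) mxinnerZr.
  by rewrite mxinner_outer subrK.
apply: addr_ge0; last by rewrite mulr_ge0 // invr_ge0 ltW.
apply: IHk => //; rewrite (leq_trans _ Bk) // proper_card //.
apply/properP; split.
  (* A zero on the diagonal persists: B'_jj is nonnegative and at most B_jj. *)
  apply/fintype.subsetP => j; rewrite !inE; apply: contra => /eqP Bj0.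
  have := psform_diag j psB'; rewrite eq_le => ->; rewrite andbT.
  rewrite /B' !mxE big_ord1 !mxE Bj0 sub0r oppr_le0.
  by rewrite mulr_ge0 ?invr_ge0 ?(ltW Bi_gt0) // -expr2 sqr_ge0.
exists i; rewrite !inE ?Bi0 // /B' !mxE big_ord1 !mxE.
by rewrite mulrA mulVf // mul1r subrr eqxx.
Qed.

Lemma bform_col B (U V : 'M[R]_n) i j :
  bform B (col i U) (col j V) = (U^T *m B *m V) i j.
Proof.
rewrite /bform tr_col -row_mul !mxE.
by apply: eq_bigr => k _; rewrite [in RHS]mxE !mxE.
Qed.

Lemma sum_sqr_orthonormal (U : 'M[R]_n) u : U^T *m U = 1%:M ->
  \sum_i (u^T *m col i U) 0 0 ^+ 2 = sqnorm u.
Proof.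
move=> /mulmx1C UU.
have -> : sqnorm u = ((u^T *m U) *m (u^T *m U)^T) 0 0.
  by rewrite trmx_mul trmxK mulmxA -(mulmxA _ U) UU mulmx1.
rewrite mxE; apply: eq_bigr => i _.
by rewrite colE mulmxA -colE [LHS]expr2 !mxE.
Qed.

Lemma sum_bform_orthonormal (U B : 'M[R]_n) : U^T *m U = 1%:M ->
  \sum_i bform B (col i U) (col i U) = \tr B.
Proof.
move=> /mulmx1C UU.
rewrite -[RHS]mulr1n -{2}[B]mul1mx -UU -mulmxA mxtrace_mulC.
by apply: eq_bigr => i _; rewrite bform_col.
Qed.

Section SingularValues.
Variables (U V Y : 'M[R]_n) (s : 'I_n -> R).
Hypotheses (UU : U^T *m U = 1%:M) (VV : V^T *m V = 1%:M).
Hypothesis s_ge0 : forall i, 0 <= s i.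
Hypothesis Ysvd : Y = \sum_i s i *: (col i U *m (col i V)^T).

Definition svd_part (P : pred 'I_n) : 'M[R]_n :=
  \sum_(i | P i) s i *: (col i U *m (col i V)^T).

Lemma sqnorm_col_orthonormal (W : 'M[R]_n) i :
  W^T *m W = 1%:M -> sqnorm (col i W) = 1.
Proof.
move=> WW; have := bform_col 1%:M W W i i.
by rewrite /bform !mulmx1 WW [RHS]mxE eqxx.
Qed.

Lemma svd_bform i : bform Y (col i U) (col i V) = s i.
Proof.
rewrite Ysvd bform_sum (bigD1 i) //= big1 ?addr0 => [|j ji]; rewrite bformZ.
  rewrite bform_outer -!/(sqnorm _) !sqnorm_col_orthonormal //.
  by rewrite !mulr1.
have colWW (W : 'M[R]_n) : W^T *m W = 1%:M ->
    ((col i W)^T *m col j W) 0 0 = 0.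
  move=> WW; have := bform_col 1%:M W W i j.
  by rewrite /bform !mulmx1 WW [RHS]mxE eq_sym (negbTE ji).
by rewrite bform_outer colWW // mul0r mulr0.
Qed.

(** With a and b the coordinates of u and v in the two singular bases, each term satisfies a b <=
    (a^2 + b^2) / 2, and Parseval's identity sums the squares. *)
Lemma form_le_svd_part (P : pred 'I_n) t : 0 <= t ->
  (forall i, P i -> s i <= t) -> form_le (svd_part P) t.
Proof.
move=> t0 sP u v; rewrite /svd_part bform_sum.
rewrite -(sum_sqr_orthonormal u UU) -(sum_sqr_orthonormal v VV).
rewrite -big_split /= mulr_sumr [leRHS](bigID P) /= ler_wpDr //.
  by apply: sumr_ge0 => i _; rewrite mulr_ge0 ?divr_ge0 // addr_ge0 ?sqr_ge0.
apply: ler_sum => i Pi; rewrite bformZ bform_outer.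
have -> : ((col i V)^T *m v) 0 0 = (v^T *m col i V) 0 0.
  by rewrite -[in RHS](trmxK (col i V)) -trmx_mul [RHS]mxE.
set a := (u^T *m _) 0 0; set b := (v^T *m _) 0 0.
have ab : 2 * (a * b) <= a ^+ 2 + b ^+ 2.
  by rewrite -subr_ge0; have := sqr_ge0 (a - b); congr (_ <= _); ring.
have ab0 : 0 <= a ^+ 2 + b ^+ 2 by rewrite addr_ge0 ?sqr_ge0.
rewrite (@le_trans _ _ (s i * ((a ^+ 2 + b ^+ 2) / 2))) //.
  by rewrite ler_wpM2l // ler_pdivlMr // mulrC.
by rewrite -[leRHS]mulrA [2^-1 * _]mulrC ler_wpM2r ?divr_ge0 ?sP.
Qed.

(** Each term is at most the mean of the two diagonal values of [B]. These are nonnegative, so the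
    sum extends to all indices, where each orthonormal basis yields the trace. *)
Lemma sum_bform_svd_le (B : 'M[R]_n) (P : pred 'I_n) : psform B ->
  \sum_(i | P i) bform B (col i U) (col i V) <= \tr B.
Proof.
move=> psB; have [_ B_ge0] := psB.
rewrite (@le_trans _ _ (\sum_i (bform B (col i U) (col i U) +
                                 bform B (col i V) (col i V)) / 2)) //.
  rewrite [leRHS](bigID P) /= ler_wpDr //.
    by apply: sumr_ge0 => i _; rewrite divr_ge0 // addr_ge0.
  by apply: ler_sum => i _; exact: psform_bform_le.
by rewrite -mulr_suml big_split /= !sum_bform_orthonormal // mulrDl -splitr.
Qed.

(** In the last factor, 1 comes from the inner product of the error [D] with [B], and 1 + tau / (t -
    tau) from its inner product with the kept part, through the sum of the kept singular values. *)
Lemma svd_threshold_error (B : 'M[R]_n) t tau :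
  psform B -> 0 <= tau -> tau < t -> form_le (Y - B) tau ->
  sqfrob (B - svd_part (fun i => t <= s i)) <=
    (t + tau) * \tr B * (2 + tau / (t - tau)).
Proof.
move=> psB tau0 taut YB.
set P := fun i => t <= s i; set Yh := svd_part P; set D := B - Yh.
have t0 : 0 <= t by rewrite (le_trans tau0) // ltW.
have trB0 : 0 <= \tr B by apply: sumr_ge0 => i _; exact: psform_diag.
have YhE : Y - Yh = svd_part (fun i => ~~ P i).
  by rewrite Ysvd (bigID P) /= addrC addrK.
(* The discarded part of [Y] has norm at most [t], the noise at most [tau]. *)
have Dle : form_le D (t + tau).
  have -> : D = (Y - Yh) + - (Y - B).
    by rewrite opprB addrC addrA subrK.
  apply: form_leD (form_leN YB); rewrite YhE; apply: form_le_svd_part => // i.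
  by rewrite /P -ltNge => /ltW.
have DB : mxinner D B <= (t + tau) * \tr B.
  have := @psform_mxtrace_ge0 ((t + tau)%:M - D) B psB.
  rewrite mxinnerBl {1}/mxinner tr_scalar_mx mul_scalar_mx linearZ /= subr_ge0.
  apply=> z; rewrite -scaleN1r bformD bformZ mulN1r subr_ge0.
  rewrite /bform -/(bform D z z) mul_mx_scalar -scalemxAl mxE -/(sqnorm z).
  have := Dle z z; lra.
have Ps : \sum_(i | P i) s i <= \tr B * (1 + tau / (t - tau)).
  have step i : P i -> s i <= bform B (col i U) (col i V) + tau.
    move=> _; have := YB (col i U) (col i V).
    rewrite -scaleN1r bformD bformZ svd_bform !sqnorm_col_orthonormal //.
    rewrite mulN1r; lra.
  have Ssum : \sum_(i | P i) s i <= \tr B + \sum_(i | P i) tau.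
    rewrite (le_trans (ler_sum _ step)) // big_split /= lerD2r.
    exact: sum_bform_svd_le.
  (* Every kept singular value is at least [t], so this bounds the number of kept values by tr B /
     (t - tau). *)
  have Scard : \sum_(i | P i) (t - tau) <= \tr B.
    rewrite sumrB lerBlDr (le_trans _ Ssum) //.
    by apply: ler_sum => i.
  rewrite (le_trans Ssum) // mulrDr mulr1 lerD2l.
  have -> : \sum_(i | P i) tau = (\sum_(i | P i) (t - tau)) * (tau / (t - tau)).
    rewrite mulr_suml; apply: eq_bigr => i _.
    by rewrite mulrCA mulfV ?mulr1 // subr_eq0 gt_eqF.
  by rewrite ler_wpM2r // divr_ge0 // subr_ge0 ltW.
rewrite sqfrob_inner {2}/D mxinnerC mxinnerBl [mxinner B D]mxinnerC.
have DYh : - mxinner Yh D <= (t + tau) * \sum_(i | P i) s i.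
  rewrite mxinnerC mxinner_sumr -sumrN mulr_sumr; apply: ler_sum => i _.
  rewrite mxinnerZr mxinner_outer -mulrN mulrC ler_wpM2r //.
  have := form_leN Dle (col i U) (col i V).
  rewrite -scaleN1r bformZ mulN1r !sqnorm_col_orthonormal //; lra.
have tt0 : 0 <= t + tau by rewrite addr_ge0.
have := ler_wpM2l tt0 Ps.
rewrite mulrA [_ * (1 + _)]mulrDr [_ * (2 + _)]mulrDr; lra.
Qed.

End SingularValues.
End BilinearForms.

(** * Moments of sums over walks *)

Section Potential.
Context (V J : finType) (ends : J -> {set V}).
Implicit Types (O : {set J}) (x z : V).

Definition opendeg O z : nat := #|[set j in O | z \in ends j]|.

(** Subtraction is truncated: a vertex counts its open edges beyond the second, and the current
    vertex counts one more once it has two. A departure along a new edge turns this extra unit into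
    a unit of the sum. *)
Definition potential O x : nat :=
  (\sum_z (opendeg O z - 2) + (2 <= opendeg O x))%N.

Lemma potential_move O x z : (potential O z <= (potential O x).+1)%N.
Proof. by rewrite /potential; lia. Qed.

Lemma opendegU1 O j z : j \notin O ->
  opendeg (j |: O) z = ((z \in ends j) + opendeg O z)%N.
Proof.
move=> jO; rewrite /opendeg.
have [zj|zj] := boolP (z \in ends j).
  rewrite (_ : [set k in j |: O | z \in ends k] = j |: [set k in O | z \in ends k]).
    by rewrite finset.cardsU1 inE (negbTE jO).
  by apply/finset.setP => k; rewrite !inE; case: eqP => [->|].
rewrite add0n; apply: eq_card => k; rewrite !inE.
by case: eqP => // ->; rewrite (negbTE zj) !andbF.
Qed.

Lemma sum_opendegU1 O j x z : j \notin O -> ends j = [set x; z]%SET -> x != z ->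
  (\sum_w (opendeg (j |: O) w - 2) =
   \sum_w (opendeg O w - 2) + (2 <= opendeg O x) + (2 <= opendeg O z))%N.
Proof.
move=> jO jxz xz.
rewrite !(bigD1 x (P := predT)) //= !(bigD1 z (P := [pred i | i != x])) /= 1?eq_sym //.
have -> : (\sum_(i | (i != x) && (i != z)) (opendeg (j |: O) i - 2) =
           \sum_(i | (i != x) && (i != z)) (opendeg O i - 2))%N.
  apply: eq_bigr => i /andP[/negbTE ix /negbTE iz].
  by rewrite opendegU1 // jxz !inE ix iz.
by rewrite !opendegU1 // jxz !inE !eqxx orbT /=; lia.
Qed.

(** The new edge adds [2 <= opendeg O x] to the sum, exactly the indicator lost by leaving x; the
    fresh vertex z has a single open edge and contributes nothing. *)
Lemma potential_open O j x z : j \notin O -> ends j = [set x; z]%SET -> x != z ->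
  opendeg O z = 0%N -> (potential (j |: O) z = potential O x)%N.
Proof.
move=> jO jxz xz z0; rewrite /potential (sum_opendegU1 jO jxz xz) opendegU1 //.
by rewrite jxz !inE eqxx orbT z0; lia.
Qed.

(** The second summand makes a closing step that had a choice of open edges at x lower the potential
    by at least one. *)
Lemma potential_close O j x z : j \in O -> ends j = [set x; z]%SET -> x != z ->
  (potential (O :\ j) z + (2 <= opendeg O x) <= potential O x)%N.
Proof.
move=> jO jxz xz; have jO' : j \notin O :\ j by rewrite !inE eqxx.
have := sum_opendegU1 jO' jxz xz.
have := opendegU1 x jO'; have := opendegU1 z jO'; rewrite finset.setD1K //.
by rewrite jxz !inE !eqxx orbT /= /potential; lia.
Qed.

End Potential.

(** * Weighted counting of walks *)

Section WalkSums.
Context (R : realFieldType) (V J : finType).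
Variables (adj : rel V) (lab : V -> V -> J) (ends : J -> {set V}).
Variable e : seq J -> R.

(* [e l] stands for the expectation of the product of the entries labelled by
   l, which is not multiplicative in l; hence the accumulator. *)
Fixpoint walk_sum (m : nat) (l : seq J) (x y : V) : R :=
  if m is m'.+1 then \sum_(z | adj x z) walk_sum m' (rcons l (lab x z)) z y
  else if x == y then e l else 0.

Variables (p theta : R) (n q : nat).
Hypothesis ends_lab : forall x y, adj x y -> ends (lab x y) = [set x; y]%SET.
Hypothesis deg_le : forall x, (#|[set y | adj x y]%SET| <= n)%N.
Hypothesis e_single : forall l j, count_mem j l = 1%N -> e l = 0.
Hypothesis e_bound : forall l (C : {set J}),
  (forall j, j \in C -> (2 <= count_mem j l)%N) ->
  `|e l| <= p ^+ #|C| * 2 ^+ (size l - 2 * #|C|).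
Hypothesis p_ge0 : 0 <= p.
Hypothesis theta_ge1 : 1 <= theta.
Hypothesis theta_np : theta ^+ 4 = n%:R * p.

(* After a walk with labels l that ends at x: A contains the visited vertices,
   O the edges that discovered a vertex and have been used once, and C edges that
   discovered a vertex and have been used again. *)
Record walk_state (l : seq J) (x : V) (A : {set V}) (O C : {set J}) : Prop :=
  WalkState {
    ws_cur : x \in A;
    ws_seen : forall j, j \in l -> ends j \subset A;
    ws_open : forall j, j \in O -> count_mem j l = 1%N;
    ws_edge : forall j, j \in O -> #|ends j| = 2;
    ws_closed : forall j, j \in C -> (2 <= count_mem j l)%N
  }.

Let rate : R := 2 * theta ^+ 2 + 3 * q%:R * theta.

(** Open edges are charged their factor p in advance. The exponent of 2 counts the letters that
    neither opened nor closed an edge, each costing at most 2 in [e_bound]. *)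
Let weight (s : nat) (x : V) (O C : {set J}) : R :=
  p ^+ (#|O| + #|C|) * 2 ^+ (s - (#|O| + 2 * #|C|)) *
  (theta ^+ 2)^-1 ^+ #|O| * theta ^+ potential ends O x.

(** The factor by which one step to z can multiply [weight]: opening, forced closing, closing with a
    choice, or any other step to a visited vertex. *)
Let gain (x : V) (A : {set V}) (O : {set J}) (z : V) : R :=
  if z \notin A then p * (theta ^+ 2)^-1
  else if lab x z \in O then
    if (opendeg ends O x <= 1)%N then theta ^+ 2 else theta
  else 2 * theta.

Let theta_gt0 : 0 < theta. Proof. exact: lt_le_trans theta_ge1. Qed.

Let rate_ge0 : 0 <= rate.
Proof. by rewrite addr_ge0 ?mulr_ge0 ?exprn_ge0 ?(ltW theta_gt0). Qed.

Let weight_ge0 s x O C : 0 <= weight s x O C.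
Proof.
have theta0 := ltW theta_gt0.
by rewrite /weight !mulr_ge0 ?exprn_ge0 ?invr_ge0 ?exprn_ge0.
Qed.

(** At most [n] openings contribute n p / theta^2 = theta^2, at most one forced closing contributes
    theta^2, and the remaining steps lead to one of at most [q] visited vertices, contributing at
    most q theta + 2 q theta. *)
Lemma sum_gain_le x (A : {set V}) (O : {set J}) : (#|A| <= q)%N ->
  \sum_(z | adj x z) gain x A O z <= rate.
Proof.
move=> Aq.
have cst_le (P : pred V) (c : R) k : 0 <= c -> (#|[set z | P z]%SET| <= k)%N ->
    \sum_(z | P z) c <= k%:R * c.
  move=> c0 Pk; rewrite sumr_const -[leLHS]mulr_natl ler_wpM2r // ler_nat.
  by rewrite (leq_trans _ Pk) // cardsE.
have subA (P : pred V) : (#|[set z | P z && (z \in A)]%SET| <= q)%N.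
  rewrite (leq_trans _ Aq) // subset_leq_card //.
  by apply/fintype.subsetP => z; rewrite inE => /andP[].
rewrite (bigID (mem A)) /= (bigID [pred z | lab x z \in O]) /=.
have -> : rate = (theta ^+ 2 + q%:R * theta) + q%:R * (2 * theta) + theta ^+ 2.
  by rewrite /rate; ring.
apply: lerD; [apply: lerD|].
- under eq_bigr => z do rewrite /gain.
  rewrite (eq_bigr (fun=> if (opendeg ends O x <= 1)%N then theta ^+ 2 else theta));
    last by move=> z /andP[/andP[_ ->] ->].
  case: ifP => ox.
    rewrite -[leLHS]addr0 lerD ?mulr_ge0 ?(ltW theta_gt0) //.
    rewrite -[leRHS]mul1r -[X in _ <= X * _]/(1%:R) cst_le ?exprn_ge0 ?(ltW theta_gt0) //.
    (* The label of an edge at x determines its other end, so closing steps from x inject into the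
       open edges at x. *)
    rewrite (leq_trans _ ox) // /opendeg -(@card_in_imset _ _ (lab x)).
      apply: subset_leq_card; apply/fintype.subsetP => _ /imsetP[z + ->].
      by rewrite !inE => /andP[/andP[/ends_lab -> _] ->]; rewrite !inE eqxx.
    move=> z z'; rewrite !inE => /andP[/andP[xz _] _] /andP[/andP[xz' _] _] lzz.
    have := ends_lab xz; rewrite lzz (ends_lab xz') => /finset.setP zz'.
    have := zz' z; have := zz' z'; rewrite !inE !eqxx !orbT.
    by case: eqP => [->|_ /= /esym/eqP //]; rewrite orbb => _ /eqP.
  rewrite -[leLHS]add0r lerD ?exprn_ge0 ?(ltW theta_gt0) // cst_le ?(ltW theta_gt0) //.
  rewrite (leq_trans _ (subA (adj x))) // subset_leq_card //.
  by apply/fintype.subsetP => z; rewrite !inE => /andP[].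
- rewrite (eq_bigr (fun=> 2 * theta)); last first.
    by move=> z /andP[/andP[_ zA] zO]; rewrite /gain zA (negbTE zO).
  rewrite cst_le ?mulr_ge0 ?(ltW theta_gt0) //.
  rewrite (leq_trans _ (subA (adj x))) // subset_leq_card //.
  by apply/fintype.subsetP => z; rewrite !inE => /andP[].
rewrite (eq_bigr (fun=> p * (theta ^+ 2)^-1)); last first.
  by move=> z /andP[_ zA]; rewrite /gain zA.
rewrite (@le_trans _ _ (n%:R * (p * (theta ^+ 2)^-1))) //.
  rewrite cst_le ?mulr_ge0 ?invr_ge0 ?exprn_ge0 ?(ltW theta_gt0) //.
  rewrite (leq_trans _ (deg_le x)) // subset_leq_card //.
  by apply/fintype.subsetP => z; rewrite !inE => /andP[].
rewrite mulrA -theta_np (exprD theta 2 2) mulfK // expf_neq0 // gt_eqF //.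
Qed.

(** Induction on the remaining steps, each costing a factor [rate]. The condition on [#|A| + m]
    keeps the visited vertices at most [q] at every choice. *)
Lemma walk_sum_le m l x y A O C :
  walk_state l x A O C -> (#|A| + m <= q.+1)%N ->
  `|walk_sum m l x y| <= rate ^+ m * weight (size l) x O C.
Proof.
elim: m l x A O C => [|m IHm] l x A O C [xA lA Ol Oe Cl] Aq /=.
  rewrite expr0 mul1r.
  (* An edge still open at the end was used exactly once, so the expectation vanishes. *)
  have [->|[j jO]] := finset.set_0Vmem O; last first.
    by rewrite (e_single (Ol _ jO)) if_same normr0.
  rewrite /weight cards0 expr0 !add0n mulr1.
  have [_|_] := eqVneq x y; last first.
    by rewrite normr0 !mulr_ge0 // exprn_ge0 // ltW.
  rewrite (le_trans (e_bound Cl)) // ler_peMr ?exprn_ege1 //.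
  by rewrite mulr_ge0 ?exprn_ge0.
have {}Aq : (#|A| + m <= q)%N by rewrite -ltnS -addnS.
have step z : adj x z -> `|walk_sum m (rcons l (lab x z)) z y| <=
    rate ^+ m * weight (size l) x O C * gain x A O z.
  move=> xz; set j := lab x z; have jE : ends j = [set x; z]%SET := ends_lab xz.
  have cnt k : count_mem k (rcons l j) = ((j == k) + count_mem k l)%N.
    by rewrite -cats1 count_cat /= addn0 addnC.
  rewrite -mulrA /gain.
  have [zA|zA] := boolP (z \in A); last first.
    rewrite -[if ~~ false then _ else _]/(p * (theta ^+ 2)^-1).
    have jl : j \notin l.
      apply/negP => /lA; rewrite jE => /fintype.subsetP/(_ z).
      by rewrite !inE eqxx orbT (negbTE zA) => /(_ isT).
    have jl0 : count_mem j l = 0%N.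
      by apply/eqP; rewrite -leqn0 leqNgt -has_count has_pred1.
    have jO : j \notin O by apply/negP => /Ol; rewrite jl0.
    have ws : walk_state (rcons l j) z (z |: A) (j |: O) C.
      split; first by rewrite !inE eqxx.
      - move=> k; rewrite mem_rcons inE => /predU1P[->|/lA kA].
          rewrite jE; apply/fintype.subsetP => w.
          by rewrite !inE => /orP[]/eqP->; rewrite ?xA ?eqxx ?orbT.
        by rewrite (fintype.subset_trans kA) // finset.subsetUr.
      - move=> k; rewrite cnt in_setU1 => /predU1P[->|kO].
          by rewrite eqxx jl0.
        have [jk|_] := eqVneq j k; first by rewrite jk kO in jO.
        by rewrite (Ol _ kO).
      - move=> k; rewrite !inE => /predU1P[->|/Oe //].
        rewrite jE cards2; case: eqP => // xz'.
        by rewrite -xz' xA in zA.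
      - by move=> k /Cl ck; rewrite cnt (leq_trans ck) // leq_addl.
    have {}ws := IHm _ _ _ _ _ ws; rewrite (le_trans (ws _)) //.
      by rewrite finset.cardsU1 zA add1n addSn ltnS.
    rewrite ler_wpM2l ?exprn_ge0 // /weight size_rcons finset.cardsU1 jO add1n.
    rewrite (potential_open jO jE); first last.
    - apply/eqP; rewrite cards_eq0 -finset.subset0; apply/fintype.subsetP => k.
      rewrite !inE => /andP[/Ol kl].
      have /lA/fintype.subsetP kA : k \in l by rewrite -has_pred1 has_count kl.
      by move=> /kA; rewrite (negbTE zA).
    - by apply: contraNneq zA => <-.
    rewrite (_ : ((size l).+1 - (#|O|.+1 + 2 * #|C|) =
                  size l - (#|O| + 2 * #|C|))%N); last by clear; lia.
    rewrite (_ : (#|O|.+1 + #|C| = (#|O| + #|C|).+1)%N) //.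
    set Y := (theta ^+ 2)^-1; rewrite [p ^+ _.+1]exprS [Y ^+ _.+1]exprS.
    by rewrite le_eqVlt; apply/orP; left; apply/eqP; ring.
  rewrite -[if ~~ true then _ else _]/(if j \in O then _ else _).
  (* Neither opening nor closing: one more uncharged letter costs 2, and the move raises the
     potential by at most one. *)
  have [jO|jO] := boolP (j \in O); last first.
    have ws : walk_state (rcons l j) z A O C.
      split=> //.
      - move=> k; rewrite mem_rcons inE => /predU1P[->|/lA //].
        by rewrite jE; apply/fintype.subsetP => w; rewrite !inE => /orP[]/eqP->.
      - move=> k kO; rewrite cnt (Ol _ kO).
        by have [jk|//] := eqVneq j k; rewrite -jk (negbTE jO) in kO.
      - by move=> k /Cl ck; rewrite cnt (leq_trans ck) // leq_addl.
    rewrite (le_trans (IHm _ _ _ _ _ ws _)) ?(leq_trans Aq) // ler_wpM2l ?exprn_ge0 //.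
    rewrite /weight size_rcons.
    set X := p ^+ _; set Y := _^-1 ^+ _.
    have X0 : 0 <= X by rewrite exprn_ge0.
    have Y0 : 0 <= Y by rewrite exprn_ge0 // invr_ge0 exprn_ge0 // ltW.
    rewrite [leRHS](_ : _ = X * 2 ^+ (size l - (#|O| + 2 * #|C|)).+1 * Y *
      theta ^+ (potential ends O x).+1); last by rewrite !exprS; ring.
    apply: ler_pM; [|by rewrite exprn_ge0 ?(ltW theta_gt0)| |].
    - by rewrite !mulr_ge0 // exprn_ge0.
    - by rewrite ler_wpM2r // ler_wpM2l // ler_weXn2l ?ler1n //; clear; lia.
    - by rewrite ler_weXn2l // potential_move.
  (* Closing: the label passes from [O] to [C]. The factor theta^-2 disappears, and the potential
     drops if there was a choice. *)
  have jlx : x != z.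
    by have := Oe _ jO; rewrite jE cards2; case: (x != z).
  have jC : j \notin C.
    by apply/negP => /Cl; rewrite (Ol _ jO).
  have ws : walk_state (rcons l j) z A (O :\ j) (j |: C).
    split=> //.
    - move=> k; rewrite mem_rcons inE => /predU1P[->|/lA //].
      by rewrite jE; apply/fintype.subsetP => w; rewrite !inE => /orP[]/eqP->.
    - by move=> k; rewrite !inE eq_sym cnt => /andP[/negbTE -> /Ol ->].
    - by move=> k; rewrite !inE => /andP[_ /Oe].
    - move=> k; rewrite !inE cnt => /predU1P[->|/Cl ck].
        by rewrite eqxx (Ol _ jO).
      by rewrite (leq_trans ck) // leq_addl.
  rewrite (le_trans (IHm _ _ _ _ _ ws _)) ?(leq_trans Aq) // ler_wpM2l ?exprn_ge0 //.
  have pot := potential_close jO jE jlx.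
  rewrite /weight size_rcons finset.cardsU1 jC [in leRHS](cardsD1 j O) jO.
  set a := #|O :\ j|; set pot' := potential _ _ z in pot *.
  rewrite add1n (_ : (a + (1 + #|C|) = a.+1 + #|C|)%N); last by clear; lia.
  rewrite (_ : ((size l).+1 - (a + 2 * (1 + #|C|)) =
                size l - (a.+1 + 2 * #|C|))%N); last by clear; lia.
  rewrite [_ ^+ a.+1]exprSr -!mulrA !ler_wpM2l ?exprn_ge0 ?invr_ge0 ?exprn_ge0 //;
    try exact: ltW.
  rewrite ler_pdivlMl ?exprn_gt0 // -exprD.
  case: ifP => ox; first by rewrite -exprD ler_weXn2l //; clear -pot; lia.
  by rewrite -exprSr ler_weXn2l //; clear -pot ox; lia.
rewrite (le_trans (ler_norm_sum _ _ _)) // (le_trans (ler_sum _ step)) //.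
rewrite -mulr_sumr exprSr [leRHS]mulrAC ler_wpM2l //.
  by rewrite mulr_ge0 // exprn_ge0.
by apply: sum_gain_le; rewrite (leq_trans _ Aq) // leq_addr.
Qed.

End WalkSums.

(** * From traces of powers to quadratic forms *)

Section PowerMethod.
Context (R : realFieldType) (V : finType).
Implicit Types (f g z : V -> R).

Lemma sum_cauchy_schwarz f g :
  (\sum_x f x * g x) ^+ 2 <= (\sum_x f x ^+ 2) * (\sum_x g x ^+ 2).
Proof.
set a := \sum_x f x ^+ 2; set b := \sum_x f x * g x; set c := \sum_x g x ^+ 2.
have a_ge0 : 0 <= a by apply: sumr_ge0 => x _; exact: sqr_ge0.
have : 0 <= \sum_x (a * g x - b * f x) ^+ 2.
  by apply: sumr_ge0 => x _; exact: sqr_ge0.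
have -> : \sum_x (a * g x - b * f x) ^+ 2 = a * (a * c - b ^+ 2).
  transitivity (\sum_x (a ^+ 2 * g x ^+ 2 - 2 * a * b * (f x * g x) + b ^+ 2 * f x ^+ 2)).
    by apply: eq_bigr => x _; ring.
  by rewrite big_split sumrB /= -!mulr_sumr -/a -/b -/c; ring.
have [a0|a_neq0] := eqVneq a 0; last first.
  by rewrite pmulr_rge0 ?subr_ge0 // lt_def a_neq0.
move=> _; rewrite a0 mul0r /b big1 ?expr0n // => x _.
have : f x ^+ 2 = 0 by apply: (psumr_eq0P (fun x _ => sqr_ge0 (f x)) a0).
by move/eqP; rewrite sqrf_eq0 => /eqP ->; rewrite mul0r.
Qed.

Variable a : V -> V -> R.

(** Matrix powers over an arbitrary finite index type, so that walks on ['I_n + 'I_n] are covered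
    without reindexing. *)
Fixpoint kernel_pow (m : nat) (x y : V) : R :=
  if m is m'.+1 then \sum_z a x z * kernel_pow m' z y else (x == y)%:R.

Definition kernel_form (m : nat) (z : V -> R) : R :=
  \sum_x z x * \sum_y kernel_pow m x y * z y.

Lemma kernel_pow1 x y : kernel_pow 1 x y = a x y.
Proof.
rewrite /= (bigD1 y) //= eqxx mulr1 big1 ?addr0 // => z /negbTE->.
by rewrite mulr0.
Qed.

Lemma kernel_powD m k x y :
  kernel_pow (m + k) x y = \sum_z kernel_pow m x z * kernel_pow k z y.
Proof.
elim: m x => [|m IHm] x.
  rewrite (bigD1 x) //= eqxx mul1r big1 ?addr0 // => z zx.
  by rewrite eq_sym (negbTE zx) mul0r.
rewrite addSn /=; under eq_bigr do rewrite IHm mulr_sumr.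
rewrite exchange_big; apply: eq_bigr => z _; rewrite mulr_suml.
by apply: eq_bigr => w _; rewrite mulrA.
Qed.

Hypothesis a_sym : forall x y, a x y = a y x.

Lemma kernel_pow_sym m x y : kernel_pow m x y = kernel_pow m y x.
Proof.
elim: m x y => [|m IHm] x y; first by rewrite /= eq_sym.
rewrite -[in RHS]addn1 kernel_powD; apply: eq_bigr => z _.
by rewrite kernel_pow1 IHm a_sym mulrC.
Qed.

Lemma kernel_formD m z :
  kernel_form (m + m) z = \sum_x (\sum_y kernel_pow m x y * z y) ^+ 2.
Proof.
rewrite /kernel_form.
transitivity (\sum_x \sum_w z x * kernel_pow m x w *
    \sum_y kernel_pow m w y * z y).
  apply: eq_bigr => x _; rewrite mulr_sumr.
  under eq_bigr do rewrite kernel_powD mulr_suml mulr_sumr.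
  rewrite exchange_big; apply: eq_bigr => w _; rewrite mulr_sumr.
  by apply: eq_bigr => y _; rewrite !mulrA.
rewrite exchange_big; apply: eq_bigr => w _; rewrite -mulr_suml expr2.
by congr (_ * _); apply: eq_bigr => x _; rewrite kernel_pow_sym mulrC.
Qed.

Lemma kernel_form_double m z :
  kernel_form m z ^+ 2 <= (\sum_x z x ^+ 2) * kernel_form (m + m) z.
Proof. by rewrite kernel_formD; exact: sum_cauchy_schwarz. Qed.

(** The form is |a^m z|^2, at most |z|^2 times the squared Frobenius norm of a^m, which is the trace
    of a^(2m) by symmetry. *)
Lemma kernel_form_trace m z :
  kernel_form (m + m) z <= (\sum_x z x ^+ 2) * \sum_x kernel_pow (m + m) x x.
Proof.
rewrite kernel_formD mulr_sumr; apply: ler_sum => x _.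
rewrite (le_trans (sum_cauchy_schwarz _ _)) // mulrC kernel_powD.
rewrite ler_wpM2l ?sumr_ge0 // => [y _|]; first exact: sqr_ge0.
by rewrite le_eqVlt (eq_bigr _ (fun y _ => congr1 _ (kernel_pow_sym m y x))) eqxx.
Qed.

Lemma kernel_trace_ge0 m : 0 <= \sum_x kernel_pow (m + m) x x.
Proof.
apply: sumr_ge0 => x _; rewrite kernel_powD; apply: sumr_ge0 => y _.
by rewrite (kernel_pow_sym m y x) -expr2 sqr_ge0.
Qed.

(* Repeated squaring: <z, a^m z>^2 <= |z|^2 <z, a^2m z> by Cauchy-Schwarz. *)
Lemma kernel_form_pow r z : kernel_form 1 z ^+ (2 ^ r.+1) <=
  (\sum_x z x ^+ 2) ^+ (2 ^ r.+1).-1 * kernel_form (2 ^ r.+1) z.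
Proof.
set s := \sum_x z x ^+ 2; have s0 : 0 <= s by apply: sumr_ge0 => x _; exact: sqr_ge0.
elim: r => [|r IHr]; first exact: (kernel_form_double 1 z).
have even_ge0 : 0 <= kernel_form 1 z ^+ (2 ^ r.+1).
  by rewrite expnS mulnC exprM sqr_ge0.
rewrite [in leLHS]expnS mulnC exprM.
rewrite (le_trans (lerXn2r 2 _ _ IHr)) ?nnegrE ?(le_trans even_ge0) //.
rewrite exprMn (le_trans (ler_wpM2l _ (kernel_form_double _ z))) -?exprM ?exprn_ge0 //.
rewrite mulrA -exprSr addnn -mul2n -expnS.
by rewrite (_ : ((2 ^ r.+1).-1 * 2).+1 = (2 ^ r.+2).-1)%N // [in RHS]expnS; lia.
Qed.

(** With Q = 2^(r+1), repeated squaring and the trace bound give <z, a z>^Q <= (tau |z|^2)^Q; Q is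
    even, so a Q-th root bounds the absolute value. *)
Lemma kernel_form_le r (tau : R) : 0 <= tau ->
  \sum_x kernel_pow (2 ^ r.+1) x x <= tau ^+ (2 ^ r.+1) ->
  forall z, `|\sum_x z x * \sum_y a x y * z y| <= tau * \sum_x z x ^+ 2.
Proof.
move=> tau0 tr z.
have -> : \sum_x z x * \sum_y a x y * z y = kernel_form 1 z.
  by apply: eq_bigr => x _; congr (_ * _); apply: eq_bigr => y _; rewrite kernel_pow1.
have := kernel_form_pow r z.
set s := \sum_x z x ^+ 2; have s0 : 0 <= s by apply: sumr_ge0 => x _; exact: sqr_ge0.
move=> Qle.
rewrite -(@ler_pXn2r _ (2 ^ r.+1)) ?expn_gt0 ?nnegrE ?mulr_ge0 //.
have -> : `|kernel_form 1 z| ^+ (2 ^ r.+1) = kernel_form 1 z ^+ (2 ^ r.+1).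
  by rewrite expnS !exprM real_normK ?num_real.
rewrite (le_trans Qle) // exprMn.
have e2 : (2 ^ r.+1 = 2 ^ r + 2 ^ r)%N by rewrite expnS; lia.
have := kernel_form_trace (2 ^ r) z; rewrite -e2 -/s => Qtr.
rewrite (le_trans (ler_wpM2l _ Qtr)) ?exprn_ge0 //.
rewrite mulrA -exprSr prednK ?expn_gt0 // mulrC ler_wpM2r ?exprn_ge0 //.
Qed.

End PowerMethod.

Local Open Scope classical_set_scope.

(** * Independence and expectations of bounded functions *)

Section BoundedMeasurable.
Context (d : measure_display) (T : measurableType d) (R : realType).
Context (P : probability T R).
Implicit Types (f g : T -> R) (A : set T).

(** The bound holds at every point, not almost everywhere, which makes closure under products and
    integrability immediate. *)
Definition bmeas f : Prop :=
  measurable_fun setT f /\ exists K : R, forall w, `|f w| <= K.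

Lemma bmeas_cst (c : R) : bmeas (fun=> c).
Proof. by split; [exact: measurable_cst | exists `|c|]. Qed.

Lemma bmeasD f g : bmeas f -> bmeas g -> bmeas (fun w => f w + g w).
Proof.
move=> [mf [K fK]] [mg [L gL]]; split; first exact: measurable_funD.
by exists (K + L) => w; rewrite (le_trans (ler_normD _ _)) ?lerD.
Qed.

Lemma bmeasM f g : bmeas f -> bmeas g -> bmeas (fun w => f w * g w).
Proof.
move=> [mf [K fK]] [mg [L gL]]; split; first exact: measurable_funM.
by exists (K * L) => w; rewrite normrM ler_pM.
Qed.

Lemma bmeasZ (c : R) f : bmeas f -> bmeas (fun w => c * f w).
Proof. exact: bmeasM (bmeas_cst c). Qed.

Lemma bmeas_sum I (r : seq I) (Q : pred I) (F : I -> T -> R) :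
  (forall i, Q i -> bmeas (F i)) -> bmeas (fun w => \sum_(i <- r | Q i) F i w).
Proof.
move=> bF; elim: r => [|i r IHr].
  rewrite (_ : (fun _ => _) = fun=> 0); first exact: bmeas_cst.
  by apply/funext => w; rewrite big_nil.
have [Qi|/negbTE nQi] := boolP (Q i); last first.
  rewrite (_ : (fun _ => _) = fun w => \sum_(j <- r | Q j) F j w) //.
  by apply/funext => w; rewrite big_cons nQi.
rewrite (_ : (fun _ => _) = fun w => F i w + \sum_(j <- r | Q j) F j w); last first.
  by apply/funext => w; rewrite big_cons Qi.
by apply: bmeasD => //; exact: bF.
Qed.

Lemma bmeas_prod I (r : seq I) (Q : pred I) (F : I -> T -> R) :
  (forall i, Q i -> bmeas (F i)) -> bmeas (fun w => \prod_(i <- r | Q i) F i w).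
Proof.
move=> bF; elim: r => [|i r IHr].
  rewrite (_ : (fun _ => _) = fun=> 1); first exact: bmeas_cst.
  by apply/funext => w; rewrite big_nil.
have [Qi|/negbTE nQi] := boolP (Q i); last first.
  rewrite (_ : (fun _ => _) = fun w => \prod_(j <- r | Q j) F j w) //.
  by apply/funext => w; rewrite big_cons nQi.
rewrite (_ : (fun _ => _) = fun w => F i w * \prod_(j <- r | Q j) F j w); last first.
  by apply/funext => w; rewrite big_cons Qi.
by apply: bmeasM => //; exact: bF.
Qed.

Lemma bmeas_indic A : measurable A -> bmeas (\1_A : T -> R).
Proof.
move=> mA; split; first exact: measurable_indic.
by exists 1 => w; rewrite indicE; case: (w \in A); rewrite ?normr1 ?normr0.
Qed.

Definition Ex f : R := \int[P]_w f w.

Lemma bmeas_integrable f : bmeas f -> P.-integrable setT (EFin \o f).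
Proof.
move=> [mf [K fK]]; apply: measurable_bounded_integrable => //.
  by rewrite (le_lt_trans (probability_le1 _ _)) // ltry.
exists K; split; first exact: num_real.
by move=> y Ky w _; exact: le_trans (fK w) (ltW Ky).
Qed.

Lemma expectation_Ex f : bmeas f -> 'E_P[f]%E = (Ex f)%:E.
Proof.
move=> bf; rewrite unlock /Ex /Rintegral fineK //.
exact: integrable_fin_num (bmeas_integrable bf).
Qed.

Lemma Ex_cst (c : R) : Ex (fun=> c) = c.
Proof. by have := expectation_cst P c; rewrite unlock /Ex /Rintegral => ->. Qed.

Lemma ExD f g : bmeas f -> bmeas g -> Ex (fun w => f w + g w) = Ex f + Ex g.
Proof. by move=> bf bg; rewrite /Ex RintegralD //; exact: bmeas_integrable. Qed.

Lemma ExZ (c : R) f : bmeas f -> Ex (fun w => c * f w) = c * Ex f.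
Proof. by move=> bf; rewrite /Ex RintegralZl //; exact: bmeas_integrable. Qed.

Lemma Ex_sum I (r : seq I) (Q : pred I) (F : I -> T -> R) :
  (forall i, Q i -> bmeas (F i)) ->
  Ex (fun w => \sum_(i <- r | Q i) F i w) = \sum_(i <- r | Q i) Ex (F i).
Proof.
move=> bF; elim: r => [|i r IHr].
  rewrite big_nil -[RHS]Ex_cst; congr Ex.
  by apply/funext => w; rewrite big_nil.
rewrite big_cons; have [Qi|/negbTE nQi] := boolP (Q i); last first.
  rewrite (_ : (fun _ => _) = fun w => \sum_(j <- r | Q j) F j w) //.
  by apply/funext => w; rewrite big_cons nQi.
rewrite (_ : (fun _ => _) = fun w => F i w + \sum_(j <- r | Q j) F j w); last first.
  by apply/funext => w; rewrite big_cons Qi.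
by rewrite ExD ?IHr //; [exact: bF | exact: bmeas_sum].
Qed.

Lemma ler_Ex f g : bmeas f -> bmeas g -> (forall w, f w <= g w) -> Ex f <= Ex g.
Proof. by move=> bf bg fg; apply: le_Rintegral => //; exact: bmeas_integrable. Qed.

Lemma Ex_norm_le f (K : R) : bmeas f -> (forall w, `|f w| <= K) -> `|Ex f| <= K.
Proof.
move=> bf fK; rewrite ler_norml -[X in X <= _ <= _]Ex_cst -[X in _ <= _ <= X]Ex_cst.
by apply/andP; split; apply: ler_Ex => // [|w]; try exact: bmeas_cst;
  have := fK w; rewrite ler_norml => /andP[].
Qed.

Lemma Ex_indic A : measurable A -> Ex (\1_A : T -> R) = fine (P A).
Proof. by move=> mA; rewrite /Ex /Rintegral integral_indic // setIT. Qed.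

(** The sum counts the positive integers up to y, hence is the integer part of y. *)
Lemma staircase (M : nat) (y : R) : 0 <= y -> y <= M%:R ->
  `|\sum_(i < M) (i.+1%:R <= y)%R%:R - y| <= 1.
Proof.
move=> y0; elim: M => [|M IHM] yM.
  by rewrite big_ord0 sub0r normrN ger0_norm // (le_trans yM).
have [yM'|yM'] := leP y M%:R.
  rewrite big_ord_recr /= (_ : (M.+1%:R <= y)%R = false) ?addr0; first exact: IHM.
  by apply/negbTE; rewrite -ltNge (le_lt_trans yM') // ltr_nat.
rewrite (eq_bigr (fun i : 'I_M.+1 =>
  (i < M)%:R + (i == M :> nat)%:R * (M.+1%:R <= y)%R%:R)); last first.
  move=> i _; have := ltn_ord i; rewrite ltnS leq_eqVlt => /predU1P[->|iM].
    by rewrite ltnn eqxx mul1r add0r.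
  rewrite iM (ltn_eqF iM) mul0r addr0.
  by rewrite (le_trans _ (ltW yM')) // ler_nat.
rewrite big_split /= big_ord_recr /= ltnn addr0.
rewrite (eq_bigr (fun=> 1)) => [|i _]; last by rewrite ltn_ord.
rewrite sumr_const card_ord big_ord_recr /= eqxx mul1r big1 ?add0r => [|i _]; last first.
  by rewrite ltn_eqF ?mul0r.
have M1 : M.+1%:R = M%:R + 1 :> R by rewrite natr1.
by have [My|My] := leP M.+1%:R y; rewrite ler_norml /=; lra.
Qed.

(* g is a uniform limit of combinations of the indicators of {g >= a}. *)
Lemma Ex_decouple (g Phi : T -> R) (c : R) : bmeas g -> bmeas Phi ->
  (forall C : set R, measurable C ->
     Ex (fun w => \1_(g @^-1` C) w * Phi w) = Ex (\1_(g @^-1` C) : T -> R) * c) ->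
  Ex (fun w => g w * Phi w) = Ex g * c.
Proof.
move=> bg bPhi gC; have [mg [K gK]] := bg; have [_ [L PhiL]] := bPhi.
have K0 : 0 <= K by have := gK point; exact: le_trans.
have L0 : 0 <= L by have := PhiL point; exact: le_trans.
have ExPhi : Ex Phi = c.
  have := gC setT measurableT; rewrite preimage_setT.
  under eq_fun do rewrite indicE in_setT mul1r.
  by move=> ->; rewrite Ex_indic // probability_setT mul1r.
have approx (dl : R) : 0 < dl ->
    `|Ex (fun w => g w * Phi w) - Ex g * c| <= dl * (L + `|c|).
  move=> dl0.
  have [M MK] : exists M : nat, 2 * K / dl <= M%:R.
    by exists (Num.truncn (2 * K / dl)).+1; rewrite ltW // truncnS_gt.
  pose D (i : nat) := g @^-1` [set y : R | i.+1%:R * dl - K <= y].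
  have mC (i : nat) : measurable [set y : R | i.+1%:R * dl - K <= y].
    by rewrite -set_itvcy; exact: measurable_itv.
  have mD i : measurable (D i).
    by rewrite -[D i]setTI; exact: mg.
  (* [g] rounded down to the grid of mesh [dl] starting at [- K]; [M] levels suffice to reach
     [K]. *)
  pose gd w := - K + dl * \sum_(i < M) \1_(D i) w.
  have bsum : bmeas (fun w => \sum_(i < M) (\1_(D i) w : R)).
    by apply: bmeas_sum => i _; exact: bmeas_indic.
  have bgd : bmeas gd by apply: bmeasD; [exact: bmeas_cst | exact: bmeasZ].
  have ggd w : `|g w - gd w| <= dl.
    have := @staircase M ((g w + K) / dl).
    have := gK w; rewrite ler_norml => /andP[gK1 gK2].
    rewrite divr_ge0 ?(ltW dl0) //; last by rewrite -lerBlDr sub0r.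
    rewrite (le_trans _ MK); last by rewrite ler_pM2r ?invr_gt0 //; lra.
    move=> /(_ isT isT).
    have -> : \sum_(i < M) (i.+1%:R <= (g w + K) / dl)%R%:R =
              \sum_(i < M) \1_(D i) w :> R.
      apply: eq_bigr => i _; rewrite indicE ler_pdivlMr //; congr (nat_of_bool _)%:R.
      by apply/idP/idP => [h|/set_mem/=]; rewrite ?inE /D /= lerBlDr.
    rewrite -(ler_pM2l dl0) mulr1 -{1}(gtr0_norm dl0) -normrM mulrBr mulrCA divff ?gt_eqF //.
    rewrite mulr1 => h; rewrite distrC (le_trans _ h) // le_eqVlt; apply/orP; left.
    by apply/eqP; congr `|_|; rewrite /gd; ring.
  have Egd : Ex (fun w => gd w * Phi w) = Ex gd * c.
    have b1 i : bmeas (fun w => \1_(D i) w * Phi w).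
      by apply: bmeasM => //; exact: bmeas_indic.
    have -> : (fun w => gd w * Phi w) =
        (fun w => - K * Phi w + dl * \sum_(i < M) \1_(D i) w * Phi w).
      by apply/funext => w; rewrite /gd -mulr_suml; ring.
    rewrite ExD ?ExZ //; try (by apply: bmeasZ => //; exact: bmeas_sum).
      rewrite ExPhi Ex_sum //.
      rewrite (eq_bigr (fun i : 'I_M => Ex (\1_(D i) : T -> R) * c)); last first.
        by move=> i _; exact: gC.
      rewrite /gd ExD //; [|exact: bmeas_cst|exact: bmeasZ].
      rewrite Ex_cst ExZ // Ex_sum => [|i _]; last exact: bmeas_indic.
      by rewrite -mulr_suml; ring.
    exact: bmeas_sum.
  have bN : bmeas (fun w => g w - gd w).
    by apply: bmeasD => //; under eq_fun do rewrite -mulN1r; exact: bmeasZ.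
  have -> : Ex (fun w => g w * Phi w) - Ex g * c =
      Ex (fun w => (g w - gd w) * Phi w) - Ex (fun w => g w - gd w) * c.
    have -> : (fun w => g w * Phi w) =
        (fun w => (g w - gd w) * Phi w + gd w * Phi w).
      by apply/funext => w; ring.
    have -> : Ex g = Ex (fun w => g w - gd w) + Ex gd.
      by rewrite -ExD //; congr Ex; apply/funext => w; ring.
    rewrite (ExD (bmeasM bN bPhi) (bmeasM bgd bPhi)) Egd; ring.
  rewrite (le_trans (ler_normB _ _)) // normrM mulrDr lerD //.
    apply: Ex_norm_le => [|w]; first exact: bmeasM.
    by rewrite normrM ler_pM.
  by rewrite ler_wpM2r //; exact: Ex_norm_le.
apply/eqP; rewrite -subr_eq0 -normr_le0; apply/ler_addgt0Pl => dl dl0.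
(* The mesh dl / (L + |c| + 1) brings the error below dl; the 1 keeps the denominator positive. *)
have S0 : 0 < L + `|c| + 1 by rewrite ltr_wpDl // addr_ge0.
rewrite addr0 (le_trans (approx (dl / (L + `|c| + 1)) _)) ?divr_gt0 //.
by rewrite -mulrA ler_piMr ?(ltW dl0) // mulrC ler_pdivrMr // mul1r; lra.
Qed.

End BoundedMeasurable.

(** * Products over independent, partially observed entries *)

Section IndependentEntries.
Context (d : measure_display) (T : measurableType d) (R : realType).
Context (P : probability T R) (n : nat).
Variables (X : 'I_n -> 'I_n -> {RV P >-> R}) (O : 'I_n -> 'I_n -> {RV P >-> bool}).
Local Notation I := ('I_n * 'I_n)%type.
Variable FE : {set I}.
Local Notation A := [set k : I + I | match k with inl ij | inr ij => ij \in FE end]%SET.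
Hypothesis indepXO : indep_on P A (entry_sigma X O).

Lemma entry_sigma_measurable k E : entry_sigma X O k E -> measurable E.
Proof. by case: k => [] [i j] /= [B mB <-]; rewrite setTI; exact: measurable_funPTI. Qed.

Lemma entry_sigma_preimage e (C : set R) : measurable C ->
  entry_sigma X O (inl e) (X e.1 e.2 @^-1` C).
Proof. by move=> mC; exists C => //; rewrite setTI. Qed.

Lemma entry_sigma_status e b : entry_sigma X O (inr e) [set w | O e.1 e.2 w = b].
Proof. by exists [set b] => //; rewrite setTI. Qed.

Lemma prod_indic (J : finType) (B : {set J}) (E : J -> set T) w :
  \prod_(j in B) \1_(E j) w = \1_(\bigcap_(j in [set` B]) E j) w :> R.
Proof.
rewrite indicE; have [|] := boolP (w \in _).
  move=> /set_mem wE; rewrite big1 // => j jB.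
  by rewrite indicE mem_set //; exact: wE.
move=> /negP wE; have [j jB jE] : exists2 j, j \in B & w \notin E j.
  apply: contrapT => nE; apply: wE; rewrite inE => j /= jB.
  by apply: contrapT => wj; apply: nE; exists j => //; apply/negP => /set_mem.
by rewrite (bigD1 j) //= indicE (negbTE jE) mul0r.
Qed.

Lemma Ex_prod_indic (B : {set I + I}) (E : I + I -> set T) :
  B \subset A -> (forall j, j \in B -> entry_sigma X O j (E j)) ->
  Ex P (fun w => \prod_(j in B) \1_(E j) w) = \prod_(j in B) fine (P (E j)).
Proof.
move=> BA BE; under eq_fun do rewrite prod_indic.
rewrite Ex_indic; last first.
  by apply: fin_bigcap_measurable => // j /= /BE; exact: entry_sigma_measurable.
rewrite indepXO // (eq_bigr (fun j => (fine (P (E j)))%:E)); last first.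
  by move=> j /BE /entry_sigma_measurable mE; rewrite fineK // fin_num_measure.
by rewrite -(big_morph EFin EFinM erefl).
Qed.

Let upd (E : I + I -> set T) k S j := if j == k then S else E j.

Let prod_upd (V : comNzRingType) (F : set T -> V) E k S (B : {set I + I}) : k \notin B ->
  \prod_(j in k |: B) F (upd E k S j) = F S * \prod_(j in B) F (E j).
Proof.
move=> kB; rewrite big_setU1 //= /upd eqxx; congr (_ * _).
by apply: eq_bigr => j jB; case: eqP => // jk; rewrite -jk jB in kB.
Qed.

Variables (h : I -> R -> R) (beta : I -> R).
Hypothesis mh : forall e, measurable_fun setT (h e).
Hypothesis bh : forall e, exists K, forall x, `|h e x| <= K.

(** With [h] and [beta] free, this covers both powers of the noise and centred observation
    indicators. *)
Definition observed_value (e : I) (w : T) : R :=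
  if O e.1 e.2 w then h e (X e.1 e.2 w) else beta e.

Let po (e : I) : R := fine (P [set w | O e.1 e.2 w]).

Lemma bmeas_value e : bmeas (fun w => h e (X e.1 e.2 w)).
Proof.
split; first exact: measurableT_comp.
by have [K hK] := bh e; exists K => w.
Qed.

Lemma observed_valueE e w : observed_value e w =
  h e (X e.1 e.2 w) * \1_[set w | O e.1 e.2 w = true] w +
  beta e * \1_[set w | O e.1 e.2 w = false] w.
Proof.
rewrite /observed_value !indicE.
have inO b : (w \in [set w | O e.1 e.2 w = b]) = (O e.1 e.2 w == b).
  by apply/idP/eqP; rewrite inE.
by rewrite !inO; case: (O _ _ w); rewrite ?mulr1 ?mulr0 ?addr0 ?add0r.
Qed.

Lemma bmeas_observed e : bmeas (observed_value e).
Proof.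
rewrite (funext (observed_valueE e)).
have mO b : measurable [set w | O e.1 e.2 w = b].
  exact: entry_sigma_measurable (entry_sigma_status e b).
by apply: bmeasD; apply: bmeasM;
  by [exact: bmeas_value | exact: bmeas_indic | exact: bmeas_cst].
Qed.

Lemma unobservedE e : fine (P [set w | O e.1 e.2 w = false]) = 1 - po e.
Proof.
have mO : measurable [set w | O e.1 e.2 w].
  exact: entry_sigma_measurable (entry_sigma_status e true).
rewrite (_ : [set w | _ = false] = ~` [set w | O e.1 e.2 w]); last first.
  by apply/seteqP; split => w /=; [move=> -> | move/negP/negbTE].
by rewrite probability_setC // fineB ?fin_num_measure.
Qed.

(** Induction on [s]. The indicators over [B] are the strengthening that makes it work: when an
    entry is peeled off, its status event and a level event of its value move into [B], and
    [Ex_decouple] passes from level events to the value. *)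
Lemma Ex_prod_observed (s : seq I) (B : {set I + I}) (E : I + I -> set T) :
  uniq s -> {subset s <= FE} -> B \subset A ->
  (forall j, j \in B -> entry_sigma X O j (E j)) ->
  (forall e, e \in s -> (inl e \notin B) && (inr e \notin B)) ->
  Ex P (fun w => (\prod_(e <- s) observed_value e w) * \prod_(j in B) \1_(E j) w)
  = (\prod_(e <- s) (po e * Ex P (fun w => h e (X e.1 e.2 w)) + (1 - po e) * beta e)) *
    \prod_(j in B) fine (P (E j)).
Proof.
elim: s B E => [|e s IHs] B E.
  move=> _ _ BA BE _; rewrite big_nil mul1r -Ex_prod_indic //.
  by congr Ex; apply/funext => w; rewrite big_nil mul1r.
move=> /= /andP[es us] sFE BA BE sB.
have /andP[lB rB] := sB e (mem_head _ _).
have eFE : e \in FE by apply: sFE; exact: mem_head.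
have sFE' : {subset s <= FE} by move=> x xs; apply: sFE; rewrite inE xs orbT.
have sB' x : x \in s -> (inl x \notin B) && (inr x \notin B).
  by move=> xs; apply: sB; rewrite inE xs orbT.
have bprod (S : {set I + I}) G : (forall j, j \in S -> entry_sigma X O j (G j)) ->
    bmeas (fun w => (\prod_(e <- s) observed_value e w) * \prod_(j in S) \1_(G j) w : R).
  move=> SG; apply: bmeasM; first by apply: bmeas_prod => x _; exact: bmeas_observed.
  by apply: bmeas_prod => j /SG /entry_sigma_measurable mG; exact: bmeas_indic.
pose Ob b := [set w | O e.1 e.2 w = b].
pose c := \prod_(e <- s) (po e * Ex P (fun w => h e (X e.1 e.2 w)) + (1 - po e) * beta e).
set D := \prod_(j in B) fine (P (E j)).
have inrA : inr e |: B \subset A.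
  by rewrite finset.subUset BA andbT finset.sub1set inE.
have updE b j : j \in inr e |: B -> entry_sigma X O j (upd E (inr e) (Ob b) j).
  rewrite /upd; case: eqP => [-> _|jk]; first exact: entry_sigma_status.
  by rewrite finset.in_setU1 => /predU1P[//|]; exact: BE.
have snotin x : x \in s -> (inl x \notin inr e |: B) && (inr x \notin inr e |: B).
  move=> xs; rewrite !finset.in_setU1 /= !negb_or.
  have /andP[-> ->] := sB' _ xs; rewrite andbT.
  by apply: contraNneq es => -[<-].
pose Phi b w := (\prod_(e <- s) observed_value e w) *
  \prod_(j in inr e |: B) \1_(upd E (inr e) (Ob b) j) w.
have PhiE b w : Phi b w = (\prod_(e <- s) observed_value e w) *
    (\1_(Ob b) w * \prod_(j in B) \1_(E j) w).
  by rewrite /Phi; congr (_ * _); exact: (prod_upd (fun S => \1_S w)).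
have bPhi b : bmeas (Phi b) by apply: bprod; exact: updE.
have ExPhi b : Ex P (Phi b) = c * (fine (P (Ob b)) * D).
  rewrite /Phi IHs //; last exact: updE.
  by rewrite (prod_upd (fun S => fine (P S))).
have split w : (\prod_(e <- e :: s) observed_value e w) * \prod_(j in B) \1_(E j) w =
    h e (X e.1 e.2 w) * Phi true w + beta e * Phi false w.
  by rewrite big_cons observed_valueE !PhiE -/(Ob true) -/(Ob false); ring.
rewrite (funext split) (ExD P (bmeasM (bmeas_value e) (bPhi true)) (bmeasZ _ (bPhi false))).
rewrite ExZ // ExPhi (@Ex_decouple _ _ _ P _ _ (c * (fine (P (Ob true)) * D))) //.
- by rewrite big_cons -/c unobservedE -/(po e); ring.
- exact: bmeas_value.
move=> C mC; set S := (X in \1_X).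
have SE : S = X e.1 e.2 @^-1` (h e @^-1` C) by [].
have mhC : measurable (h e @^-1` C) by rewrite -[X in measurable X]setTI; exact: mh.
have mS : measurable S := entry_sigma_measurable (entry_sigma_preimage e mhC).
have lnot : inl e \notin inr e |: B by rewrite finset.in_setU1 /=.
rewrite Ex_indic //.
(* Both events of the peeled entry are now in the family, so the induction hypothesis factors them
   off. *)
pose E2 := upd (upd E (inr e) (Ob true)) (inl e) S.
transitivity (Ex P (fun w => (\prod_(e <- s) observed_value e w) *
    \prod_(j in inl e |: (inr e |: B)) \1_(E2 j) w)).
  congr Ex; apply/funext => w.
  by rewrite /E2 (prod_upd (fun S => \1_S w : R)) // /Phi mulrCA.
rewrite IHs //.
- rewrite /E2 (prod_upd (fun S => fine (P S))) // (prod_upd (fun S => fine (P S))) //.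
  by rewrite -/c -/D; ring.
- by rewrite finset.subUset inrA andbT finset.sub1set inE.
- move=> j; rewrite /E2 /(upd _ (inl e)); case: eqP => [-> _|jk].
    exact: (entry_sigma_preimage e mhC).
  by rewrite finset.in_setU1 => /predU1P[//|]; exact: updE.
- move=> x xs; have /andP[xl xr] := snotin _ xs.
  rewrite !(finset.in_setU1 _ (inl e)) !negb_or xl xr andbT /= andbT.
  by apply: contraNneq es => -[<-].
Qed.

Lemma Ex_prod_observed_value (s : seq I) : uniq s -> {subset s <= FE} ->
  Ex P (fun w => \prod_(e <- s) observed_value e w) =
  \prod_(e <- s) (po e * Ex P (fun w => h e (X e.1 e.2 w)) + (1 - po e) * beta e).
Proof.
move=> us sFE; have := @Ex_prod_observed s finset.set0 (fun=> setT) us sFE.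
rewrite finset.sub0set big_set0 mulr1 => <- //; first last.
- by move=> e; rewrite !inE.
- by move=> j; rewrite inE.
by congr Ex; apply/funext => w; rewrite big_set0 mulr1.
Qed.

End IndependentEntries.

(** * Moments of the noise *)

Lemma clip_norm_le (R : realType) (x : R) : `|clip x| <= 1.
Proof. by rewrite /clip; case: ifPn => ?; [|case: ifPn => ?]; rewrite ler_norml; lra. Qed.

Lemma clip_id (R : realType) (x : R) : `|x| <= 1 -> clip x = x.
Proof.
by rewrite ler_norml => /andP[x1 x2]; rewrite /clip ltNge x2 /= ltNge x1.
Qed.

Lemma measurable_clip (R : realType) : measurable_fun setT (@clip R).
Proof.
rewrite (_ : @clip R = (fun x => Num.max (-1) (Num.min x 1))).
  by apply: measurable_maxr => //; apply: measurable_minr.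
apply/funext => x; rewrite /clip.
have [x1|x1] := ltP 1 x; first by rewrite max_r //; lra.
by have [x2|x2] := ltP x (-1).
Qed.

Section NoiseMoments.
Context (d : measure_display) (T : measurableType d) (R : realType).
Context (P : probability T R) (n : nat) (mo : model) (M : 'M[R]_n) (p : R).
Variables (X : 'I_n -> 'I_n -> {RV P >-> R}) (O : 'I_n -> 'I_n -> {RV P >-> bool}).
Hypothesis model_XO : data_model mo M p X O.
Hypothesis M_le1 : forall i j, `|M i j| <= 1.
Hypothesis p01 : 0 <= p <= 1.
Local Notation I := ('I_n * 'I_n)%type.
Local Notation FE := (free_entries mo n).

Let p_ge0 : 0 <= p. Proof. by case/andP: p01. Qed.
Let q_ge0 : 0 <= 1 - p. Proof. by case/andP: p01; rewrite subr_ge0. Qed.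
Let pM_le1 e : `|p * M e.1 e.2| <= 1.
Proof. by case/andP: p01 => p0 p1; rewrite normrM ger0_norm // mulr_ile1. Qed.

Lemma status_prob e : fine (P [set w | O e.1 e.2 w]) = p.
Proof. by rewrite (data_observed model_XO). Qed.

(** The entry of Y - pM with the data clipped: data are bounded by 1 only almost surely, and
    clipping makes the noise bounded everywhere. *)
Definition noise (e : I) (w : T) : R :=
  if O e.1 e.2 w then clip (X e.1 e.2 w) - p * M e.1 e.2 else - (p * M e.1 e.2).

Let dev (k : nat) (e : I) (x : R) : R := (clip x - p * M e.1 e.2) ^+ k.

Let dev_bound e x : `|clip x - p * M e.1 e.2| <= 2.
Proof.
rewrite (le_trans (ler_normB _ _)) //.
by have := clip_norm_le x; have := pM_le1 e; lra.
Qed.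

Let dev_norm_le k e x : `|dev k e x| <= 2 ^+ k.
Proof. by rewrite normrX lerXn2r ?nnegrE. Qed.

Let mdev k e : measurable_fun setT (dev k e).
Proof.
apply: measurable_funX; apply: measurable_funD; first exact: measurable_clip.
exact: measurable_cst.
Qed.

Let bdev k e : exists K, forall x, `|dev k e x| <= K.
Proof. by exists (2 ^+ k) => x. Qed.

Definition noise_moment (k : nat) (e : I) : R :=
  p * Ex P (fun w => dev k e (X e.1 e.2 w)) + (1 - p) * (- (p * M e.1 e.2)) ^+ k.

Lemma noise_exp k (e : I) w : noise e w ^+ k =
  observed_value X O (dev k) (fun e => (- (p * M e.1 e.2)) ^+ k) e w.
Proof. by rewrite /noise /observed_value /dev; case: ifP. Qed.

Lemma bmeas_noise e : bmeas (noise e).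
Proof.
rewrite (_ : noise e = observed_value X O (dev 1) (fun e => (- (p * M e.1 e.2)) ^+ 1) e).
  by apply: bmeas_observed.
by apply/funext => w; rewrite -noise_exp expr1.
Qed.

Let bclip e : bmeas (fun w => clip (X e.1 e.2 w)).
Proof.
split; first by apply: measurableT_comp => //; exact: measurable_clip.
by exists 1 => w; exact: clip_norm_le.
Qed.

(** Clipping changes the data only on a null set. *)
Lemma Ex_clip_data e : Ex P (fun w => clip (X e.1 e.2 w)) = M e.1 e.2.
Proof.
apply: EFin_inj; rewrite -(data_mean model_XO) -expectation_Ex //.
rewrite unlock; apply: ae_eq_integral => //.
- by apply/measurable_EFinP; apply: measurableT_comp => //; exact: measurable_clip.
- exact/measurable_EFinP.
by apply: filterS (data_bounded model_XO e.1 e.2) => w Xw _; rewrite clip_id.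
Qed.

Lemma noise_moment0 e : noise_moment 0 e = 1.
Proof. by rewrite /noise_moment /dev !expr0 Ex_cst; ring. Qed.

Lemma noise_moment1 e : noise_moment 1 e = 0.
Proof.
rewrite /noise_moment; under eq_fun do rewrite /dev expr1.
rewrite (ExD P (bclip e) (bmeas_cst _ _)) Ex_clip_data Ex_cst expr1; ring.
Qed.

Let bdevX k e : bmeas (fun w => dev k e (X e.1 e.2 w)).
Proof. exact: bmeas_value. Qed.

Lemma noise_moment_le k e : `|noise_moment k e| <= 2 ^+ k.
Proof.
rewrite /noise_moment (le_trans (ler_normD _ _)) // [`|p * _|]normrM.
rewrite [`|(1 - p) * _|]normrM (ger0_norm p_ge0) (ger0_norm q_ge0).
rewrite [leRHS](_ : _ = p * 2 ^+ k + (1 - p) * 2 ^+ k); last by ring.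
rewrite lerD // ler_wpM2l //; first by apply: Ex_norm_le => // w; exact: dev_norm_le.
rewrite normrX normrN lerXn2r ?nnegrE //.
by rewrite (le_trans (pM_le1 e)) // ler1n.
Qed.

(** The second moment is p E[clip(x)^2] - (p m)^2, and clip(x)^2 <= 1. *)
Lemma noise_moment2_le e : noise_moment 2 e <= p.
Proof.
rewrite /noise_moment.
have -> : (fun w => dev 2 e (X e.1 e.2 w)) =
    (fun w => clip (X e.1 e.2 w) * clip (X e.1 e.2 w) +
      ((- (2 * (p * M e.1 e.2))) * clip (X e.1 e.2 w) + (p * M e.1 e.2) ^+ 2)).
  by apply/funext => w; rewrite /dev; ring.
rewrite (ExD P (bmeasM (bclip e) (bclip e)) (bmeasD (bmeasZ _ (bclip e)) (bmeas_cst _ _))).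
rewrite (ExD P (bmeasZ _ (bclip e)) (bmeas_cst _ _)) (ExZ P _ (bclip e)).
rewrite Ex_clip_data Ex_cst.
set S := Ex P _; set m := M _ _.
have S1 : S <= 1.
  rewrite -(Ex_cst P 1); apply: ler_Ex; [exact: bmeasM|exact: bmeas_cst|move=> w].
  by rewrite -expr2 -real_normK ?num_real // exprn_ile1 // clip_norm_le.
have -> : p * (S + (- (2 * (p * m)) * m + (p * m) ^+ 2)) + (1 - p) * (- (p * m)) ^+ 2
  = p * S - (p * m) ^+ 2 by ring.
by rewrite lerBlDr (le_trans (ler_wpM2l p_ge0 S1)) // mulr1 lerDl sqr_ge0.
Qed.

(** The noise is at most 2 in absolute value; all but two of its factors are bounded by 2, and the
    remaining second moment by [p]. *)
Lemma noise_moment_SS_le k e : `|noise_moment k.+2 e| <= p * 2 ^+ k.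
Proof.
have bd2 : bmeas (fun w => 2 ^+ k * dev 2 e (X e.1 e.2 w)) by exact: bmeasZ.
have Ele : `|Ex P (fun w => dev k.+2 e (X e.1 e.2 w))| <=
    2 ^+ k * Ex P (fun w => dev 2 e (X e.1 e.2 w)).
  have devle w : `|dev k.+2 e (X e.1 e.2 w)| <= 2 ^+ k * dev 2 e (X e.1 e.2 w).
    rewrite /dev -(addn2 k) exprD normrM [`|_ ^+ 2|]ger0_norm ?sqr_ge0 //.
    by rewrite ler_wpM2r ?sqr_ge0 // dev_norm_le.
  rewrite -(ExZ P) // ler_norml; apply/andP; split; last first.
    by apply: ler_Ex => // w; rewrite (le_trans (ler_norm _)).
  rewrite -mulN1r -(ExZ P) //; apply: ler_Ex => [||w] //; first exact: bmeasZ.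
  by rewrite mulN1r; have := devle w; rewrite ler_norml => /andP[].
rewrite /noise_moment (le_trans (ler_normD _ _)) // [`|p * _|]normrM.
rewrite [`|(1 - p) * _|]normrM (ger0_norm p_ge0) (ger0_norm q_ge0).
rewrite [leRHS]mulrC (le_trans _ (ler_wpM2l _ (noise_moment2_le e))) ?exprn_ge0 //.
rewrite /noise_moment mulrDr [2 ^+ k * (p * _)]mulrCA lerD //; first by rewrite ler_wpM2l.
rewrite [leRHS]mulrCA ler_wpM2l // -(addn2 k) exprD normrM [`|_ ^+ 2|]ger0_norm ?sqr_ge0 //.
rewrite ler_wpM2r ?sqr_ge0 // normrX normrN lerXn2r ?nnegrE //.
by rewrite (le_trans (pM_le1 e)) // ler1n.
Qed.

(** The value 0 outside the free entries lets the vanishing and size bounds hold for every list, as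
    the hypotheses of [walk_sum_le] demand. *)
Definition noise_prod (l : seq I) : R :=
  if all (mem FE) l then Ex P (fun w => \prod_(e <- l) noise e w) else 0.

(** Equal letters are grouped into powers, and independence applies to the distinct entries that
    remain. *)
Lemma noise_prodE l : all (mem FE) l ->
  noise_prod l = \prod_e noise_moment (count_mem e l) e.
Proof.
move=> lFE; rewrite /noise_prod lFE.
pose h e := dev (count_mem e l) e.
pose b e : R := (- (p * M e.1 e.2)) ^+ (count_mem e l).
have -> : (fun w => \prod_(e <- l) noise e w) =
    (fun w => \prod_(e <- undup l) observed_value X O h b e w).
  apply/funext => w; rewrite -big_undup_iterop_count; apply: eq_bigr => e _.
  by rewrite -/(noise e w ^+ count_mem e l) noise_exp.
have mh e : measurable_fun setT (h e) by exact: mdev.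
have bh e : exists K, forall x, `|h e x| <= K by exact: bdev.
rewrite (Ex_prod_observed_value (data_indep model_XO) b mh bh) ?undup_uniq //; last first.
  by move=> e; rewrite mem_undup => /(allP lFE).
rewrite big_uniq ?undup_uniq //= [RHS](bigID (mem l)) /= [X in _ * X]big1 ?mulr1.
  apply: eq_big => [e|e _]; first by rewrite mem_undup.
  by rewrite status_prob.
by move=> e /count_memPn ->; rewrite noise_moment0.
Qed.

Lemma noise_prod_single l e : count_mem e l = 1%N -> noise_prod l = 0.
Proof.
move=> le; have [lFE|lFE] := boolP (all (mem FE) l); last by rewrite /noise_prod (negbTE lFE).
by rewrite noise_prodE // (bigD1 e) //= le noise_moment1 mul0r.
Qed.

Lemma noise_prod_le l (C : {set I}) : (forall e, e \in C -> (2 <= count_mem e l)%N) ->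
  `|noise_prod l| <= p ^+ #|C| * 2 ^+ (size l - 2 * #|C|).
Proof.
move=> Cl; have [lFE|lFE] := boolP (all (mem FE) l); last first.
  by rewrite /noise_prod (negbTE lFE) normr0 mulr_ge0 ?exprn_ge0.
rewrite noise_prodE // normr_prod.
(* Each entry of [C] trades two occurrences for one factor p; [ex] counts the occurrences left, each
   worth at most 2. *)
pose ex e := (count_mem e l - (if e \in C then 2 else 0))%N.
rewrite (@le_trans _ _ (\prod_e ((if e \in C then p else 1) * 2 ^+ ex e))) //.
  apply: ler_prod => e _; rewrite normr_ge0 /= /ex.
  case: ifPn => [/Cl|_]; last by rewrite mul1r subn0 noise_moment_le.
  by case: (count_mem e l) => [|[|k]] // _; rewrite subSS subSS subn0 noise_moment_SS_le.
rewrite big_split /= -big_mkcond /= prodr_const ler_wpM2l ?exprn_ge0 //.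
rewrite -expr_sum le_eqVlt; apply/orP; left; apply/eqP; congr (_ ^+ _).
have sizeE : (\sum_e count_mem e l = size l)%N.
  elim: l {Cl lFE ex} => [|x l IHl] /=; first by rewrite big1.
  rewrite big_split /= IHl (bigD1 x) //= eqxx big1 ?addn0 // => e.
  by rewrite eq_sym => /negbTE ->.
have CE : (\sum_(e : I) (if e \in C then 2 else 0) = 2 * #|C|)%N.
  by rewrite -big_mkcond /= sum_nat_const mulnC.
rewrite -sizeE -CE -sumnB // => e _.
by case: ifP => // /Cl.
Qed.

End NoiseMoments.

(** * Variance of the observed proportion and moments of the trace *)

Section TraceMoment.
Context (d : measure_display) (T : measurableType d) (R : realType).
Context (P : probability T R) (n : nat) (mo : model) (M : 'M[R]_n) (p : R).
Variables (X : 'I_n -> 'I_n -> {RV P >-> R}) (O : 'I_n -> 'I_n -> {RV P >-> bool}).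
Hypothesis model_XO : data_model mo M p X O.
Hypothesis M_le1 : forall i j, `|M i j| <= 1.
Hypothesis p01 : 0 <= p <= 1.
Local Notation I := ('I_n * 'I_n)%type.
Local Notation FE := (free_entries mo n).
Local Notation noise := (noise M p X O).
Local Notation noise_prod := (noise_prod mo M p X O).

Let p_ge0 : 0 <= p. Proof. by case/andP: p01. Qed.

(** The centred status indicators [o e] have mean 0 and variance p - p^2; independence removes the
    cross terms. *)
Lemma Ex_sqr_phat : (0 < #|FE|)%N ->
  Ex P (fun w => (phat mo O w - p) ^+ 2) <= p / #|FE|%:R.
Proof.
move=> FE0.
pose o := observed_value X O (fun _ _ => 1 - p) (fun=> - p).
have mh (_ : I) : measurable_fun setT (fun _ : R => 1 - p) by exact: measurable_cst.
have bh (_ : I) : exists K : R, R -> `|1 - p| <= K by exists `|1 - p|.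
have bo e : bmeas (o e) by apply: bmeas_observed.
have FR0 : #|FE|%:R != 0 :> R by rewrite pnatr_eq0 -lt0n.
have phE w : (phat mo O w - p) ^+ 2 =
    (#|FE|%:R^-1) ^+ 2 * \sum_(e in FE) \sum_(f in FE) o e w * o f w.
  have -> : phat mo O w - p = #|FE|%:R^-1 * \sum_(e in FE) o e w.
    have -> : \sum_(e in FE) o e w = #|[set ij in FE | O ij.1 ij.2 w]%SET|%:R - #|FE|%:R * p.
      rewrite (eq_bigr (fun e => (O e.1 e.2 w)%:R - p)); last first.
        by move=> e _; rewrite /o /observed_value; case: ifP => _ /=; ring.
      rewrite sumrB sumr_const mulr_natl; congr (_ - _).
      rewrite -sum1_card natr_sum big_mkcond [RHS]big_mkcond /=.
      apply: eq_bigr => e _; rewrite inE.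
      by case: (e \in FE) => //=; case: (O _ _ w).
    by rewrite mulrBr mulrA mulVf // mul1r mulrC.
  rewrite exprMn; congr (_ * _); rewrite expr2 mulr_suml.
  by apply: eq_bigr => e _; rewrite mulr_sumr.
have boo e f : bmeas (fun w => o e w * o f w) by exact: bmeasM.
rewrite (funext phE) ExZ; last by apply: bmeas_sum => e _; exact: bmeas_sum.
rewrite Ex_sum => [|e _]; last exact: bmeas_sum.
have Eoo e f : e \in FE -> f \in FE ->
    Ex P (fun w => o e w * o f w) <= (e == f)%:R * p.
  move=> eF fF; have [<-|ef] := eqVneq e f.
    pose o2 := observed_value X O (fun _ _ => (1 - p) ^+ 2) (fun=> p ^+ 2).
    have mh2 (_ : I) : measurable_fun setT (fun _ : R => (1 - p) ^+ 2) by exact: measurable_cst.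
    have bh2 (_ : I) : exists K : R, R -> `|(1 - p) ^+ 2| <= K by exists `|(1 - p) ^+ 2|.
    have -> : (fun w => o e w * o e w) = (fun w => \prod_(e <- [:: e]) o2 e w).
      apply/funext => w; rewrite big_seq1 /o /o2 /observed_value.
      by case: ifP => _; ring.
    rewrite (Ex_prod_observed_value (data_indep model_XO) (fun=> p ^+ 2) mh2 bh2) //; last first.
      by move=> x; rewrite inE => /eqP->.
    rewrite big_seq1 (status_prob model_XO) Ex_cst mul1r.
    have -> : p * (1 - p) ^+ 2 + (1 - p) * p ^+ 2 = p - p ^+ 2 by ring.
    by rewrite gerBl sqr_ge0.
  have -> : (fun w => o e w * o f w) = (fun w => \prod_(e <- [:: e; f]) o e w).
    by apply/funext => w; rewrite big_cons big_seq1.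
  rewrite (Ex_prod_observed_value (data_indep model_XO) (fun=> - p) mh bh) //; last 2 first.
  - by rewrite /= inE ef.
  - by move=> x; rewrite !inE => /orP[]/eqP->.
  rewrite big_cons (status_prob model_XO) Ex_cst.
  by rewrite (_ : p * _ + _ = 0) ?mul0r //; ring.
rewrite (@le_trans _ _ ((#|FE|%:R^-1) ^+ 2 * \sum_(e in FE) \sum_(f in FE) (e == f)%:R * p)) //.
  rewrite ler_wpM2l ?sqr_ge0 //; apply: ler_sum => e eF.
  by rewrite Ex_sum //; apply: ler_sum => f fF; exact: Eoo.
rewrite (eq_bigr (fun=> p)) => [|e eF]; last first.
  rewrite (bigD1 e) //= eqxx mul1r big1 ?addr0 // => f /andP[_ /negbTE fe].
  by rewrite eq_sym fe mul0r.
rewrite sumr_const -[p *+ _]mulr_natl le_eqVlt; apply/orP; left; apply/eqP.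
by rewrite expr2 -mulrA (mulrA _ _ p) mulVf // mul1r mulrC.
Qed.

Variables (V : finType) (adj : rel V) (lab : V -> V -> I).
Hypothesis lab_FE : forall x y, adj x y -> lab x y \in FE.

Definition noise_kernel (w : T) (x y : V) : R :=
  if adj x y then noise (lab x y) w else 0.

Lemma bmeas_kernel_pow m x y : bmeas (fun w => kernel_pow (noise_kernel w) m x y).
Proof.
elim: m x => [|m IHm] x /=; first exact: bmeas_cst.
apply: bmeas_sum => z _; apply: bmeasM => //.
have [xz|xz] := boolP (adj x z).
  rewrite (_ : (fun w => noise_kernel w x z) = noise (lab x z)).
    exact: (bmeas_noise X O M_le1 p01).
  by apply/funext => w; rewrite /noise_kernel xz.
rewrite (_ : (fun w => noise_kernel w x z) = fun=> 0); first exact: bmeas_cst.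
by apply/funext => w; rewrite /noise_kernel (negbTE xz).
Qed.

(** The prefix [l] holds the noise factors of the steps already taken, since the expectation can be
    evaluated only once the whole walk is known. *)
Lemma Ex_kernel_pow m l x y : all (mem FE) l ->
  Ex P (fun w => (\prod_(e <- l) noise e w) * kernel_pow (noise_kernel w) m x y) =
  walk_sum adj lab noise_prod m l x y.
Proof.
have bl l' : bmeas (fun w => \prod_(e <- l') noise e w).
  by apply: bmeas_prod => e _; exact: (bmeas_noise X O M_le1 p01).
elim: m l x => [|m IHm] l x lFE /=.
  have [_|_] := eqVneq x y.
    rewrite /noise_prod lFE; congr Ex; apply/funext => w.
    by rewrite mulr1.
  rewrite -[RHS](Ex_cst P); congr Ex; apply/funext => w.
  by rewrite mulr0.
have -> : (fun w => (\prod_(e <- l) noise e w) *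
      (\sum_z noise_kernel w x z * kernel_pow (noise_kernel w) m z y)) =
    (fun w => \sum_(z | adj x z) (\prod_(e <- rcons l (lab x z)) noise e w) *
      kernel_pow (noise_kernel w) m z y).
  apply/funext => w; rewrite mulr_sumr [RHS]big_mkcond /=; apply: eq_bigr => z _.
  rewrite /noise_kernel; case: ifP => _; last by rewrite mul0r mulr0.
  by rewrite -cats1 big_cat big_seq1 mulrA.
rewrite Ex_sum => [|z xz]; last by apply: bmeasM => //; exact: bmeas_kernel_pow.
apply: eq_bigr => z xz; apply: IHm.
by rewrite all_rcons lFE andbT; exact: lab_FE.
Qed.

Variables (theta : R) (ends : I -> {set V}).
Hypothesis ends_lab : forall x y, adj x y -> ends (lab x y) = [set x; y]%SET.
Hypothesis deg_le : forall x, (#|[set y | adj x y]%SET| <= n)%N.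
Hypothesis theta_ge1 : 1 <= theta.
Hypothesis theta_np : theta ^+ 4 = n%:R * p.

Lemma Ex_trace_le q :
  Ex P (fun w => \sum_x kernel_pow (noise_kernel w) q x x) <=
  #|V|%:R * (2 * theta ^+ 2 + 3 * q%:R * theta) ^+ q.
Proof.
rewrite Ex_sum => [|x _]; last exact: bmeas_kernel_pow.
rewrite mulr_natl -sumr_const; apply: ler_sum => x _.
have -> : Ex P (fun w => kernel_pow (noise_kernel w) q x x) =
    walk_sum adj lab noise_prod q [::] x x.
  rewrite -Ex_kernel_pow //; congr Ex; apply/funext => w.
  by rewrite big_nil mul1r.
rewrite (le_trans (ler_norm _)) //.
(* The empty walk has only its start visited and no discovering edges, so its weight is 1. *)
have st : walk_state ends [::] x [set x]%SET finset.set0 finset.set0.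
  by split => // [|j|j|j]; rewrite ?finset.in_set0 // finset.set11.
have := @walk_sum_le R V I adj lab ends noise_prod p theta n q ends_lab deg_le
  (@noise_prod_single _ _ _ _ _ _ _ _ _ _ model_XO M_le1 p01)
  (@noise_prod_le _ _ _ _ _ _ _ _ _ _ model_XO M_le1 p01)
  p_ge0 theta_ge1 theta_np q [::] x x _ _ _ st.
rewrite cards1 add1n leqnn => /(_ isT) /le_trans; apply.
have theta_ge0 : 0 <= theta by exact: le_trans theta_ge1.
rewrite ler_piMr ?exprn_ge0 ?addr_ge0 ?mulr_ge0 ?exprn_ge0 //.
have o0 z : opendeg ends finset.set0 z = 0%N.
  by apply: eq_card0 => j; rewrite !inE.
by rewrite cards0 /potential o0 big1 ?expr0 ?mulr1 // => z _; rewrite o0.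
Qed.

End TraceMoment.

(* [f] need not be measurable: the integral of a nonnegative function is a
   supremum over the simple functions below it. *)
Lemma expectation_le_bmeas (d : measure_display) (T : measurableType d)
    (R : realType) (P : probability T R) (f g : T -> R) :
  bmeas g -> (forall w, 0 <= f w <= g w) -> ('E_P[f] <= (Ex P g)%:E)%E.
Proof.
move=> bg fg; rewrite -expectation_Ex // unlock.
have f0 w : (0 <= (f w)%:E)%E by rewrite lee_fin; case/andP: (fg w).
have g0 w : (0 <= (g w)%:E)%E.
  by rewrite lee_fin; case/andP: (fg w); exact: le_trans.
rewrite !ge0_integralTE //; apply: le_ereal_sup => _ [h hf <-].
exists h => // w; apply: le_trans (hf w) _.
by rewrite lee_fin; case/andP: (fg w).
Qed.

(** * From a small trace to a small spectral norm of the noise *)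

Section TraceTest.
Context (d : measure_display) (T : measurableType d) (R : realType).
Context (P : probability T R) (n : nat) (M : 'M[R]_n) (p : R).
Variables (X : 'I_n -> 'I_n -> {RV P >-> R}) (O : 'I_n -> 'I_n -> {RV P >-> bool}).
Hypothesis M_sym : M^T = M.
Hypothesis M_le1 : forall i j, `|M i j| <= 1.
Hypothesis p01 : 0 <= p <= 1.
Variables (theta tau : R).
Hypothesis theta_ge1 : 1 <= theta.
Hypothesis theta_np : theta ^+ 4 = n%:R * p.
Hypothesis tau_ge0 : 0 <= tau.
Local Notation I := ('I_n * 'I_n)%type.

(** [F] is the trace of the q-th power of the clipped noise kernel. The factor 2n covers the larger
    vertex set, that of the asymmetric model; the last clause avoids the null set where data exceed
    1. *)
Definition trace_test (q : nat) (F : T -> R) : Prop :=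
  [/\ bmeas F, forall w, 0 <= F w,
    Ex P F <= (2 * n)%:R * (2 * theta ^+ 2 + 3 * q%:R * theta) ^+ q &
    forall w, (forall i j, `|X i j w| <= 1) -> F w <= tau ^+ q ->
      form_le (observed_mx X O w - p *: M) tau].

Lemma noise_observed w i j : `|X i j w| <= 1 ->
  noise M p X O (i, j) w = (observed_mx X O w - p *: M) i j.
Proof.
by move=> Xw; rewrite /noise !mxE /=; case: ifP => _; rewrite ?clip_id ?sub0r.
Qed.

Lemma bformE (A : 'M[R]_n) u v :
  bform A u v = \sum_i u i 0 * \sum_j A i j * v j 0.
Proof.
rewrite /bform -mulmxA mxE; apply: eq_bigr => i _; rewrite mxE; congr (_ * _).
by rewrite mxE.
Qed.

Lemma trace_test_symmetric r : data_model Symmetric M p X O ->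
  exists F, trace_test (2 ^ r.+1) F.
Proof.
move=> model_XO.
pose adj (x y : 'I_n) := true.
(* Walks on the complete graph with loops; an edge is labelled by its entry on or above the
   diagonal. *)
pose lab (x y : 'I_n) : I := if (x <= y)%N then (x, y) else (y, x).
pose ends (e : I) := [set e.1; e.2]%SET.
have lab_FE x y : adj x y -> lab x y \in free_entries Symmetric n.
  by rewrite /lab; case: leqP => [xy|/ltnW yx] _; rewrite inE.
have ends_lab x y : adj x y -> ends (lab x y) = [set x; y]%SET.
  by rewrite /ends /lab; case: ifP => //= _ _; rewrite finset.setUC.
have deg_le (x : 'I_n) : (#|[set y | adj x y]%SET| <= n)%N.
  by rewrite (leq_trans (max_card _)) // card_ord.
have labC x y : lab x y = lab y x.
  rewrite /lab; case: (ltngtP x y) => // xy; rewrite ?leqnn //.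
  by congr (_, _); exact: val_inj.
have ksym w x y : noise_kernel M p X O adj lab w x y = noise_kernel M p X O adj lab w y x.
  by rewrite /noise_kernel labC.
exists (fun w => \sum_x kernel_pow (noise_kernel M p X O adj lab w) (2 ^ r.+1) x x).
split.
- by apply: bmeas_sum => x _; apply: bmeas_kernel_pow.
- by move=> w; rewrite expnS mul2n -addnn kernel_trace_ge0.
- have := Ex_trace_le model_XO M_le1 p01 lab_FE ends_lab deg_le theta_ge1 theta_np.
  move=> /(_ (2 ^ r.+1)%N) /le_trans; apply.
  have theta_ge0 : 0 <= theta by exact: le_trans theta_ge1.
  rewrite card_ord ler_wpM2r ?exprn_ge0 ?addr_ge0 ?mulr_ge0 ?exprn_ge0 //.
  by rewrite ler_nat leq_pmull.
move=> w Xw Fw.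
have Q := kernel_form_le (ksym w) tau_ge0 Fw.
set A := observed_mx X O w - p *: M.
have kE i j : noise_kernel M p X O adj lab w i j = A i j.
  rewrite /noise_kernel /= /lab; case: ifP => _; first exact: noise_observed.
  rewrite noise_observed // /A !mxE.
  have [-> ->] := data_sym model_XO erefl j i w.
  by rewrite -[in LHS]M_sym mxE.
have AT : A^T = A by apply/matrixP => i j; rewrite mxE -!kE ksym.
have QA (z : 'cV[R]_n) : `|bform A z z| <= tau * sqnorm z.
  rewrite bformE sqnormE; apply: le_trans (Q (fun i => z i 0)).
  rewrite le_eqVlt; apply/orP; left; apply/eqP; congr `|_|.
  apply: eq_bigr => i _; congr (_ * _).
  by apply: eq_bigr => j _; rewrite kE.
move=> u v.
(* Polarisation: 4 u^T A v is the difference of the quadratic forms at u + v and u - v, and the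
   parallelogram law adds up the norms. *)
have := QA (u + v); have := QA (u + (-1) *: v).
have sqE z : sqnorm z = bform 1%:M z z by rewrite /bform mulmx1.
rewrite !sqE !(bformDl, bformDr, bformZl, bformZr) (bformC v u AT) !ler_norml.
move=> /andP[h1 _] /andP[_ h2]; lra.
Qed.

Lemma trace_test_asymmetric r : data_model Asymmetric M p X O ->
  exists F, trace_test (2 ^ r.+1) F.
Proof.
move=> model_XO.
(* Walks on the bipartite graph of rows and columns: the kernel is the symmetric dilation with
   off-diagonal blocks A and A^T. Labels of non-adjacent pairs are arbitrary. *)
pose V := ('I_n + 'I_n)%type.
pose adj (x y : V) := match x, y with
  | inl _, inr _ | inr _, inl _ => true | _, _ => false end.
pose lab (x y : V) : I := match x, y with
  | inl i, inr j | inr j, inl i => (i, j) | inl i, inl j | inr i, inr j => (i, j) end.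
pose ends (e : I) : {set V} := [set inl e.1; inr e.2]%SET.
have lab_FE x y : adj x y -> lab x y \in free_entries Asymmetric n by rewrite inE.
have ends_lab x y : adj x y -> ends (lab x y) = [set x; y]%SET.
  by case: x y => [i|i] [j|j] //= _; rewrite /ends //= finset.setUC.
have deg_le (x : V) : (#|[set y | adj x y]%SET| <= n)%N.
  have cI (f : 'I_n -> V) : (#|f @: [set: 'I_n]%SET| <= n)%N.
    by rewrite (leq_trans (leq_imset_card _ _)) // cardsT card_ord.
  case: x => i; [apply: leq_trans (cI inr)|apply: leq_trans (cI inl)];
    apply: subset_leq_card; apply/fintype.subsetP => -[j|j]; rewrite inE //= => _;
    by apply/imsetP; exists j; rewrite ?inE.
have ksym w x y : noise_kernel M p X O adj lab w x y = noise_kernel M p X O adj lab w y x.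
  by rewrite /noise_kernel; case: x y => [i|i] [j|j].
exists (fun w => \sum_x kernel_pow (noise_kernel M p X O adj lab w) (2 ^ r.+1) x x).
split.
- by apply: bmeas_sum => x _; apply: bmeas_kernel_pow.
- by move=> w; rewrite expnS mul2n -addnn kernel_trace_ge0.
- have := Ex_trace_le model_XO M_le1 p01 lab_FE ends_lab deg_le theta_ge1 theta_np (2 ^ r.+1).
  by rewrite card_sum card_ord addnn -mul2n.
move=> w Xw Fw.
have Q := kernel_form_le (ksym w) tau_ge0 Fw.
set A := observed_mx X O w - p *: M.
have kE i j : noise_kernel M p X O adj lab w (inl i) (inr j) = A i j.
  by rewrite /noise_kernel /= noise_observed.
move=> u v; pose z (x : V) : R := match x with inl i => u i 0 | inr j => v j 0 end.
have sumV (F : V -> R) : \sum_x F x = \sum_i F (inl i) + \sum_j F (inr j).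
  exact: big_sumType.
have zz : \sum_x z x ^+ 2 = sqnorm u + sqnorm v by rewrite sumV !sqnormE.
have zAz : \sum_x z x * \sum_y noise_kernel M p X O adj lab w x y * z y =
    bform A u v + bform A u v.
  rewrite sumV; congr (_ + _); rewrite bformE.
    apply: eq_bigr => i _; rewrite sumV big1 ?add0r => [|j _]; last first.
      by rewrite /noise_kernel mul0r.
    by congr (_ * _); apply: eq_bigr => j _; rewrite kE.
  under [RHS]eq_bigr do rewrite mulr_sumr.
  rewrite exchange_big; apply: eq_bigr => j _.
  rewrite sumV [X in _ + X]big1 ?addr0 => [|i _]; last first.
    by rewrite /noise_kernel mul0r.
  by rewrite mulr_sumr; apply: eq_bigr => i _; rewrite ksym kE /=; ring.
have := Q z; rewrite zAz zz ler_norml => /andP[_]; lra.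
Qed.

End TraceTest.

(** * The mean squared error *)

Section Loss.
Context (R : realType) (n : nat).
Implicit Types (M : 'M[R]_n).

Definition loss (A M : 'M[R]_n) : R :=
  (n%:R ^+ 2)^-1 * \sum_i \sum_j (A i j - M i j) ^+ 2.

Lemma loss_ge0 A M : 0 <= loss A M.
Proof.
rewrite mulr_ge0 ?invr_ge0 ?sqr_ge0 //.
by apply: sumr_ge0 => i _; apply: sumr_ge0 => j _; exact: sqr_ge0.
Qed.

Lemma sum_le_sqr (F : 'I_n -> 'I_n -> R) c :
  (forall i j, F i j <= c) -> \sum_i \sum_j F i j <= n%:R ^+ 2 * c.
Proof.
move=> Fc; rewrite (@le_trans _ _ (\sum_(i < n) \sum_(j < n) c)) //.
  by apply: ler_sum => i _; apply: ler_sum => j _.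
rewrite sumr_const sumr_const card_ord -mulrnA -[leLHS]mulr_natl natrM expr2.
by [].
Qed.

Lemma loss_clip_le4 (W M : 'M[R]_n) : (0 < n)%N -> (forall i j, `|M i j| <= 1) ->
  loss (map_mx (@clip R) W) M <= 4.
Proof.
move=> n0 M1; rewrite /loss ler_pdivrMl ?exprn_gt0 ?ltr0n //.
apply: sum_le_sqr => i j; rewrite mxE.
have := clip_norm_le (W i j); have := M1 i j; rewrite !ler_norml => /andP[? ?] /andP[? ?].
rewrite (_ : 4 = 2 ^+ 2); last by ring.
by rewrite -[leLHS]real_normK ?num_real // lerXn2r ?nnegrE // ler_norml; lra.
Qed.

(** Truncation to [-1, 1] brings no value farther from a point of that interval. *)
Lemma loss_clip_le (W M : 'M[R]_n) : (forall i j, `|M i j| <= 1) ->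
  loss (map_mx (@clip R) W) M <= (n%:R ^+ 2)^-1 * sqfrob (W - M).
Proof.
move=> M1; rewrite /loss ler_wpM2l ?invr_ge0 ?sqr_ge0 //.
apply: ler_sum => i _; apply: ler_sum => j _; rewrite !mxE.
have := M1 i j; rewrite ler_norml => /andP[? ?].
rewrite -[leLHS]real_normK ?num_real // -[leRHS]real_normK ?num_real //.
rewrite lerXn2r ?nnegrE // /clip.
case: ltP => h1; [|case: ltP => h2 //].
  by rewrite !ger0_norm; lra.
by rewrite !ler0_norm; lra.
Qed.

Lemma sqfrob_le M : (forall i j, `|M i j| <= 1) -> sqfrob M <= n%:R ^+ 2.
Proof.
move=> M1; rewrite -[leRHS]mulr1; apply: sum_le_sqr => i j.
by rewrite -real_normK ?num_real // exprn_ile1.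
Qed.

Lemma psdmx_psform M : psdmx M -> psform M.
Proof.
move=> [/is_hermitianmxP MT Mge0]; split; last exact: Mge0.
by rewrite {2}MT expr0 scale1r map_mx_id.
Qed.

Lemma mxtrace_le M : (forall i j, `|M i j| <= 1) -> \tr M <= n%:R.
Proof.
move=> M1; rewrite -[n in leRHS]card_ord -sum1_card natr_sum.
by apply: ler_sum => i _; rewrite (le_trans (ler_norm _)).
Qed.

(** The deterministic half: [svd_threshold_error] applied to B = pM, followed by division by [ph] in
    place of [p]. *)
Lemma usvt_loss_le (eta p ph : R) (Y M : 'M[R]_n) s U V :
  0 < eta < 1 -> (0 < n)%N -> 0 < p -> is_svd Y s U V -> psdmx M ->
  (forall i j, `|M i j| <= 1) -> `|ph - p| <= eta / 16 * p ->
  form_le (Y - p *: M) ((2 + eta / 2) * Num.sqrt (n%:R * p)) ->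
  loss (usvt eta ph s U V) M <=
    64 * (2 + 10 / eta) / Num.sqrt (n%:R * p) + 8 * ((ph - p) ^+ 2 / p ^+ 2).
Proof.
move=> /andP[eta0 eta1] n0 p0 [s0 UU VV Ysvd] psM M1 php YM.
set sg := Num.sqrt (n%:R * p) in YM *.
have nR0 : 0 < n%:R :> R by rewrite ltr0n.
have np0 : 0 < n%:R * p by rewrite mulr_gt0.
have sg0 : 0 < sg by rewrite sqrtr_gt0.
have sg2 : sg ^+ 2 = n%:R * p by rewrite sqr_sqrtr // ltW.
have /andP[ph1 ph2] : p - eta / 16 * p <= ph <= p + eta / 16 * p.
  by move: php; rewrite ler_norml => /andP[]; rewrite lerBrDr lerBlDr addrC => ? ?; lra.
have etap : 0 < eta * p < p by rewrite mulr_gt0 // gtr_pMl.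
have phhalf : p / 2 <= ph by lra.
have ph0 : 0 < ph by apply: lt_le_trans phhalf; rewrite divr_gt0.
set t := (2 + eta) * Num.sqrt (n%:R * ph).
have sph0 : 0 <= Num.sqrt (n%:R * ph) by exact: sqrtr_ge0.
have nph : Num.sqrt (n%:R * ph) ^+ 2 = n%:R * ph.
  by rewrite sqr_sqrtr // mulr_ge0 // ltW.
(* The tolerance eta / 16 serves here: (2 + eta)^2 (1 - eta / 16) >= (2 + 3 eta / 4)^2 on (0, 1).
   This leaves the gap eta / 4 above the noise level 2 + eta / 2. *)
have t_lo : (2 + 3 * eta / 4) * sg <= t.
  rewrite -ler_sqr ?nnegrE ?mulr_ge0 ?(ltW sg0) //; try lra.
  rewrite !exprMn sg2 nph [leRHS]mulrCA [leLHS]mulrCA ler_pM2l //.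
  rewrite (@le_trans _ _ ((2 + eta) ^+ 2 * ((1 - eta / 16) * p))) //; last first.
    by rewrite ler_wpM2l ?sqr_ge0 //; lra.
  rewrite mulrA ler_wpM2r ?(ltW p0) //; nra.
have t_hi : t <= 5 * sg.
  rewrite -ler_sqr ?nnegrE ?mulr_ge0 ?(ltW sg0) //; try lra.
  rewrite !exprMn sg2 nph [leRHS]mulrCA [leLHS]mulrCA ler_pM2l //.
  rewrite (@le_trans _ _ ((2 + eta) ^+ 2 * (2 * p))) //.
    by rewrite ler_wpM2l ?sqr_ge0 //; lra.
  rewrite mulrA ler_wpM2r ?(ltW p0) //; nra.
set tau := (2 + eta / 2) * sg in YM.
have esg : 0 < eta * sg < sg by rewrite mulr_gt0 // gtr_pMl.
have tau0 : 0 <= tau by rewrite mulr_ge0 ?(ltW sg0) //; lra.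
have gap : eta / 4 * sg <= t - tau by rewrite /tau; lra.
have taut : tau < t by rewrite -subr_gt0 (lt_le_trans _ gap) //; lra.
have psB : psform (p *: M).
  have [MT Mge0] := psdmx_psform psM; split; first by rewrite linearZ /= MT.
  by move=> z; rewrite bformZ mulr_ge0 // ltW.
set Yh := svd_part U V s (fun i => t <= s i).
have := svd_threshold_error UU VV s0 Ysvd psB tau0 taut YM; rewrite -/Yh => DB.
have trB : \tr (p *: M) <= p * n%:R.
  by rewrite linearZ /= ler_wpM2l ?(ltW p0) // mxtrace_le.
(* Indeed tau <= (5 / 2) sg while t - tau >= (eta / 4) sg. *)
have ratio : tau / (t - tau) <= 10 / eta.
  rewrite ler_pdivrMr ?subr_gt0 // mulrAC ler_pdivlMr //.
  rewrite (@le_trans _ _ (10 * (eta / 4 * sg))) //; last by rewrite ler_wpM2l.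
  by rewrite /tau; nra.
have DB2 : sqfrob (p *: M - Yh) <= 8 * sg * (p * n%:R) * (2 + 10 / eta).
  have trB0 : 0 <= \tr (p *: M) by apply: sumr_ge0 => i _; exact: psform_diag.
  have ratio0 : 0 <= tau / (t - tau) by rewrite divr_ge0 // subr_ge0 ltW.
  have tt : t + tau <= 8 * sg by rewrite /tau; lra.
  rewrite (le_trans DB) // ler_pM ?mulr_ge0 ?addr_ge0 ?(le_trans tau0 (ltW taut)) //.
    by rewrite ler_pM ?addr_ge0 ?(le_trans tau0 (ltW taut)).
  by rewrite lerD2l.
have WE : usvt eta ph s U V = map_mx (@clip R) (ph^-1 *: Yh).
  rewrite /usvt gt_eqF //; congr (map_mx _ (_ *: _)).
  by apply: eq_bigl => i; rewrite inE.
rewrite WE (le_trans (loss_clip_le _ M1)) //.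
have WM : sqfrob (ph^-1 *: Yh - M) <=
    2 * ph^-1 ^+ 2 * (sqfrob (p *: M - Yh) + (ph - p) ^+ 2 * sqfrob M).
  rewrite /sqfrob [(ph - p) ^+ 2 * _]mulr_sumr -big_split mulr_sumr /=.
  apply: ler_sum => i _; rewrite [(ph - p) ^+ 2 * _]mulr_sumr -big_split mulr_sumr /=.
  apply: ler_sum => j _; rewrite !mxE.
  set y := Yh i j; set m := M i j.
  have -> : ph^-1 * y - m = - (ph^-1 * ((p * m - y) + (ph - p) * m)).
    by field; rewrite gt_eqF.
  rewrite sqrrN exprMn -mulrA [leRHS]mulrCA ler_wpM2l ?sqr_ge0 //.
  rewrite -[X in _ <= 2 * (_ + X)]exprMn.
  have := sqr_ge0 ((p * m - y) - (ph - p) * m); lra.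
have M2 := sqfrob_le M1.
have iph : ph^-1 ^+ 2 <= 4 / p ^+ 2.
  rewrite exprVn -[4 / _]invf_div lef_pV2 ?posrE ?divr_gt0 ?exprn_gt0 //.
  rewrite ler_pdivrMr // (_ : ph ^+ 2 * 4 = (2 * ph) ^+ 2); last by ring.
  by rewrite lerXn2r ?nnegrE ?mulr_ge0 ?(ltW p0) ?(ltW ph0) //; lra.
rewrite ler_pdivrMl ?exprn_gt0 // (le_trans WM) //.
(* The constant 64 is 2 * 4 * 8: from (a + b)^2 <= 2 a^2 + 2 b^2, from ph >= p / 2, and from t + tau
   <= 8 sg. *)
rewrite (@le_trans _ _ (2 * (4 / p ^+ 2) * (8 * sg * (p * n%:R) * (2 + 10 / eta) +
   (ph - p) ^+ 2 * n%:R ^+ 2))) //.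
  have sq0 (A : 'M[R]_n) : 0 <= sqfrob A.
    by apply: sumr_ge0 => i _; apply: sumr_ge0 => j _; exact: sqr_ge0.
  apply: ler_pM; first by rewrite mulr_ge0 ?sqr_ge0.
  - by rewrite addr_ge0 // mulr_ge0 ?sqr_ge0.
  - by rewrite ler_wpM2l.
  - by rewrite lerD // ler_wpM2l ?sqr_ge0.
rewrite le_eqVlt; apply/orP; left; apply/eqP.
have -> : p = sg ^+ 2 / n%:R by rewrite sg2 mulrAC divff ?gt_eqF ?mul1r.
by field; rewrite !gt_eqF.
Qed.

End Loss.

(** * Choice of the order of the moment *)

Section MomentChoice.
Context (R : realType).

Lemma bernoulli_exprn (x : R) m : 0 <= x -> 1 + m%:R * x <= (1 + x) ^+ m.
Proof.
move=> x0; elim: m => [|m IHm]; first by rewrite mul0r addr0 expr0.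
rewrite exprS (le_trans _ (ler_wpM2l _ IHm)) ?addr_ge0 //.
have := mulr_ge0 (ler0n R m) (sqr_ge0 x); rewrite -natr1; nra.
Qed.

(** Bernoulli's inequality gives b^m >= m (b - 1), whose square outgrows any linear function. *)
Lemma linear_le_geometric (b K : R) : 1 < b -> 0 <= K ->
  exists m0 : nat, forall m, (m0 <= m)%N -> K * m.+1%:R <= (b ^+ m) ^+ 2.
Proof.
move=> b1 K0; pose x := b - 1; have x0 : 0 < x by rewrite subr_gt0.
exists (Num.truncn (2 * K / x ^+ 2)).+1 => m mm.
have mK : 2 * K <= x ^+ 2 * m%:R.
  rewrite [leRHS]mulrC -ler_pdivrMr ?exprn_gt0 // (le_trans (ltW (truncnS_gt _))) //.
  by rewrite ler_nat.
have m1 : 1 <= m%:R :> R by rewrite ler1n (leq_trans _ mm).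
have bm : m%:R * x <= b ^+ m.
  have := bernoulli_exprn m (ltW x0); rewrite /x addrCA subrr addr0.
  by apply: le_trans; rewrite lerDr.
rewrite (@le_trans _ _ ((m%:R * x) ^+ 2)) //.
  rewrite exprMn -natr1 (@le_trans _ _ (2 * K * m%:R)) //.
    by rewrite -mulrA mulrCA ler_wpM2l //; lra.
  rewrite [leRHS](_ : _ = x ^+ 2 * m%:R * m%:R); last by ring.
  by rewrite ler_wpM2r.
by rewrite lerXn2r ?nnegrE ?mulr_ge0 ?exprn_ge0 ?(ltW x0) // (le_trans ler01) ?ltW.
Qed.

(* The witness is q = 2^(a + 1 + c) with a constant and 2^c of order log n. *)
Lemma moment_choice (rho kappa eps : R) : 0 < rho < 1 -> 0 < kappa -> 0 < eps ->
  exists n0 : nat, forall (n : nat) (p : R), (n0 <= n)%N -> (0 < n)%N ->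
    n%:R `^ (-1 + eps) <= p ->
  exists r, 3 * (2 ^ r.+1)%:R <= kappa * Num.sqrt (Num.sqrt (n%:R * p)) /\
    rho ^+ (2 ^ r.+1) <= (n%:R ^+ 2)^-1.
Proof.
move=> /andP[rho0 rho1] kappa0 eps0.
(* With 2^c >= m + 1 and n < 2^(m+1), the base 1/4 yields 4^-(m+1) <= n^-2. *)
have [a rhoa] : exists a : nat, rho ^+ (2 ^ a.+1) <= 4^-1.
  pose x := rho^-1 - 1.
  have x0 : 0 < x by rewrite subr_gt0 invf_gt1.
  exists (Num.truncn (3 / x)).
  rewrite -[rho]invrK exprVn lef_pV2 ?posrE ?exprn_gt0 ?invr_gt0 //.
  have := bernoulli_exprn (2 ^ (Num.truncn (3 / x)).+1) (ltW x0).
  rewrite /x addrCA subrr addr0 -/x; apply: le_trans.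
  have : 3 / x <= (2 ^ (Num.truncn (3 / x)).+1)%:R.
    rewrite (le_trans (ltW (truncnS_gt _))) // ler_nat.
    by rewrite ltnW // ltn_expl.
  rewrite ler_pdivrMr //; lra.
(* The exponent eps / 8 gives np >= n^eps >= (b^m)^8, hence (np)^(1/4) >= (b^m)^2, with m the
   integer part of log2 n. *)
pose b : R := 2 `^ (eps / 8).
have b1 : 1 < b.
  rewrite /b /powR pnatr_eq0 /= expR_gt1 mulr_gt0 ?divr_gt0 //.
  by rewrite ln_gt0 // ltr1n.
(* The factor 2 absorbs the rounding 2^c <= 2 (m + 1). *)
pose K : R := 3 * (2 ^ a.+1)%:R * 2 / kappa.
have K0 : 0 <= K by rewrite divr_ge0 ?mulr_ge0 // ltW.
have [m0 m0P] := linear_le_geometric b1 K0.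
exists (2 ^ m0)%N => n p n0n n0 pn.
pose m := trunc_log 2 n.
have mn : (2 ^ m <= n < 2 ^ m.+1)%N by rewrite trunc_logP // trunc_log_ltn.
have m0m : (m0 <= m)%N.
  by rewrite -ltnS -(@ltn_exp2l 2) //; case/andP: mn => _; apply: leq_ltn_trans.
pose c := up_log 2 m.+1.
exists (a + c)%N; rewrite -addSn expnD.
have c_hi : (m.+1 <= 2 ^ c)%N by exact: up_logP.
have c_lo : (2 ^ c <= 2 * m.+1)%N.
  rewrite /c; case: m {mn m0m c c_hi} => [|m] //.
  have /andP[+ _] := @up_log_bounds 2 m.+2 isT isT.
  case: (up_log 2 m.+2) => [|k] //= km.
  by rewrite expnS leq_mul2l /= ltnW.
split; last first.
  rewrite exprM (@le_trans _ _ ((4^-1) ^+ (2 ^ c))) //.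
    by rewrite lerXn2r ?nnegrE ?exprn_ge0 // ltW.
  rewrite (@le_trans _ _ ((4^-1) ^+ m.+1)) //.
    by rewrite ler_wiXn2l // ?invf_le1 ?ler1n.
  rewrite exprVn lef_pV2 ?posrE ?exprn_gt0 ?ltr0n //.
  rewrite (_ : 4 = 2 ^+ 2); last by ring.
  rewrite -exprM mulnC exprM lerXn2r ?nnegrE //.
  by rewrite -natrX ler_nat ltnW //; case/andP: mn.
have nR0 : 0 < n%:R :> R by rewrite ltr0n.
have np_ge : (b ^+ m) ^+ 8 <= n%:R * p.
  apply: (@le_trans _ _ (n%:R * n%:R `^ (-1 + eps))); last by rewrite ler_pM2l.
  rewrite -{1}(powRr1 (ltW nR0)) -powRD ?(gt_eqF nR0) ?implybT // addrA subrr add0r.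
  have b8 : b ^+ 8 = 2 `^ eps.
    by rewrite -powR_mulrn ?powR_ge0 // -powRrM divfK.
  rewrite -exprM mulnC exprM b8 -[leLHS]powR_mulrn ?powR_ge0 //.
  rewrite -powRrM mulrC powRrM powR_mulrn //.
  apply: ge0_ler_powR; [exact: ltW | by rewrite nnegrE exprn_ge0 | by rewrite nnegrE | ].
  by rewrite -natrX ler_nat; case/andP: mn.
have b0 : 0 <= b by rewrite powR_ge0.
have theta_ge : (b ^+ m) ^+ 2 <= Num.sqrt (Num.sqrt (n%:R * p)).
  have sqrt_ge (y z : R) : 0 <= y -> y ^+ 2 <= z -> y <= Num.sqrt z.
    by move=> y0 yz; rewrite -[y]ger0_norm // -sqrtr_sqr ler_wsqrtr.
  apply: (sqrt_ge); first by rewrite !exprn_ge0.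
  apply: (sqrt_ge); first by rewrite !exprn_ge0.
  by apply: le_trans np_ge; rewrite -!(exprM (b ^+ m)).
rewrite (le_trans _ (ler_wpM2l (ltW kappa0) (le_trans (m0P _ m0m) theta_ge))) //.
rewrite /K mulrA [kappa * _]mulrC divfK ?gt_eqF //.
rewrite natrM mulrA -[leRHS]mulrA ler_wpM2l ?mulr_ge0 //.
by rewrite -natrM ler_nat.
Qed.

End MomentChoice.

(** * Integration of the pointwise loss bound *)

Section Risk.
Context (R : realType) (n : nat) (eta p : R) (M : 'M[R]_n) (mo : model).
Context (d : measure_display) (T : measurableType d) (P : probability T R).
Variables (X : 'I_n -> 'I_n -> {RV P >-> R}) (O : 'I_n -> 'I_n -> {RV P >-> bool}).
Variables (s : T -> 'I_n -> R) (U V : T -> 'M[R]_n).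
Hypothesis eta01 : 0 < eta < 1.
Hypothesis n_gt0 : (0 < n)%N.
Hypothesis psM : psdmx M.
Hypothesis M_le1 : forall i j, `|M i j| <= 1.
Hypothesis p01 : 0 <= p <= 1.
Hypothesis model_XO : data_model mo M p X O.
Hypothesis svdY : forall w, is_svd (observed_mx X O w) (s w) (U w) (V w).

Local Notation estimate := (fun w => usvt eta (phat mo O w) (s w) (U w) (V w)).

Let estimate_le4 w : loss (estimate w) M <= 4.
Proof. exact: loss_clip_le4. Qed.

Lemma MSE_le4 : (MSE P M estimate <= 4%:E)%E.
Proof.
rewrite -[X in (_ <= X%:E)%E](Ex_cst P 4); apply: expectation_le_bmeas.
  exact: bmeas_cst.
by move=> w; rewrite -/(loss _ _) loss_ge0 estimate_le4.
Qed.

Lemma card_free_entries : (n <= #|free_entries mo n|)%N.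
Proof.
rewrite -[leqLHS](card_ord n) -(card_codom (f := fun i : 'I_n => (i, i))); last by move=> i j [].
apply: subset_leq_card; apply/fintype.subsetP => _ /codomP[i ->].
by case: mo; rewrite inE /=.
Qed.

Lemma bmeas_phat : bmeas (phat mo O).
Proof.
rewrite (_ : phat mo O = fun w => #|free_entries mo n|%:R^-1 *
    \sum_(e in free_entries mo n) \1_[set w | O e.1 e.2 w] w).
  apply: bmeasZ; apply: bmeas_sum => e _; apply: bmeas_indic.
  by rewrite (_ : [set w | _] = O e.1 e.2 @^-1` [set true]) //; exact: measurable_funPTI.
apply/funext => w; rewrite /phat mulrC; congr (_ * _).
rewrite -sum1_card natr_sum big_mkcond [RHS]big_mkcond /=.
apply: eq_bigr => e _; rewrite inE indicE.
have -> : (w \in [set w | O e.1 e.2 w]) = O e.1 e.2 w by apply/idP/idP; rewrite inE.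
by case: (e \in _) => //=; case: (O _ _ w).
Qed.

Let large_data i j : set T := [set w | 1 < `|X i j w|].

Let mlarge i j : measurable (large_data i j).
Proof.
have -> : large_data i j = (fun w => `|X i j w|) @^-1` `]1, +oo[.
  by apply/seteqP; split => w /=; rewrite in_itv /= andbT.
rewrite -[X in measurable X]setTI; apply: (measurableT_comp _ _ measurableT) => //.
Qed.

Lemma Ex_large_data i j : Ex P (\1_(large_data i j) : T -> R) = 0.
Proof.
rewrite Ex_indic // (_ : P (large_data i j) = 0%E) //.
apply/negligibleP => //; have := data_bounded model_XO i j.
apply: negligibleS => w /= Xw; apply/negP.
by rewrite -ltNge.
Qed.

Hypothesis np_ge1 : 1 <= n%:R * p.
Let theta : R := Num.sqrt (Num.sqrt (n%:R * p)).
Let sg : R := Num.sqrt (n%:R * p).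
Let tau : R := (2 + eta / 2) * sg.

(** The loss never exceeds 4, so each bad event is paid for by a nonnegative measurable function
    that is at least 4 on it. Integrating the sum is Markov's inequality, without measurability of
    the estimator. *)
Lemma MSE_le_trace r :
  (MSE P M estimate <= (64 * (2 + 10 / eta) / sg +
    (8 + (32 / eta) ^+ 2) / (n%:R * p) +
    8 * n%:R * ((2 * theta ^+ 2 + 3 * (2 ^ r.+1)%:R * theta) / tau) ^+ (2 ^ r.+1))%:E)%E.
Proof.
have /andP[eta0 eta1] := eta01; have /andP[p0 p1] := p01.
have nR0 : 0 < n%:R :> R by rewrite ltr0n.
have p_gt0 : 0 < p.
  rewrite lt_def p0 andbT; apply: contraTneq np_ge1 => ->.
  by rewrite mulr0 -ltNge.
have np0 : 0 < n%:R * p by rewrite mulr_gt0.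
have sg0 : 0 < sg by rewrite sqrtr_gt0.
have tau0 : 0 < tau by rewrite mulr_gt0 // addr_gt0 // divr_gt0.
have th2 : theta ^+ 2 = sg by rewrite sqr_sqrtr // ltW.
have th4 : theta ^+ 4 = n%:R * p.
  by rewrite (exprM theta 2 2) th2 sqr_sqrtr // ltW.
have th1 : 1 <= theta by rewrite -[1]sqrtr1 ler_wsqrtr // -[leLHS]sqrtr1 ler_wsqrtr.
have Msym : M^T = M by case: (psdmx_psform psM).
set q := (2 ^ r.+1)%N.
have [F [bF F0 EF Fform]] : exists F, trace_test M p X O theta tau q F.
  move: model_XO; case: mo => mXO.
    exact: (trace_test_asymmetric M_le1 p01 th1 th4 (ltW tau0) r mXO).
  exact: (trace_test_symmetric Msym M_le1 p01 th1 th4 (ltW tau0) r mXO).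
pose L w : R := \sum_i \sum_j \1_(large_data i j) w.
have bL : bmeas L.
  by apply: bmeas_sum => i _; apply: bmeas_sum => j _; exact: bmeas_indic.
have bph : bmeas (fun w => (phat mo O w - p) ^+ 2).
  have bp : bmeas (fun w => phat mo O w - p).
    by apply: bmeasD; [exact: bmeas_phat | exact: bmeas_cst].
  exact: (bmeasM bp bp).
(* In [C1], 8 comes from [usvt_loss_le]; the square satisfies (32 / eta)^2 (eta / 16)^2 = 4 and pays
   for a deviation of the observed proportion. *)
set C0 := 64 * (2 + 10 / eta) / sg; set C1 := 8 + (32 / eta) ^+ 2.
have C00 : 0 <= C0 by rewrite !mulr_ge0 ?invr_ge0 ?(ltW sg0) ?addr_ge0 ?divr_ge0 ?(ltW eta0).
have C10 : 0 <= C1 by rewrite addr_ge0 ?sqr_ge0.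
pose g w := C0 + (C1 / p ^+ 2 * (phat mo O w - p) ^+ 2 + (4 / tau ^+ q * F w + 4 * L w)).
have b3 := bmeasZ 4 bL; have b2 := bmeasZ (4 / tau ^+ q) bF.
have b1 := bmeasZ (C1 / p ^+ 2) bph.
have bg : bmeas g.
  by apply: bmeasD; [exact: bmeas_cst | apply: bmeasD => //; exact: bmeasD].
have L0 w : 0 <= L w.
  by apply: sumr_ge0 => i _; apply: sumr_ge0 => j _; rewrite indicE.
have lossg w : 0 <= loss (estimate w) M <= g w.
  rewrite loss_ge0 /=.
  have t1 : 0 <= C1 / p ^+ 2 * (phat mo O w - p) ^+ 2.
    by rewrite mulr_ge0 ?divr_ge0 ?sqr_ge0.
  have t2 : 0 <= 4 / tau ^+ q * F w by rewrite mulr_ge0 ?divr_ge0 ?exprn_ge0 ?(ltW tau0).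
  have t3 : 0 <= 4 * L w by rewrite mulr_ge0.
  have [php|php] := leP `|phat mo O w - p| (eta / 16 * p); last first.
    suff : 4 <= C1 / p ^+ 2 * (phat mo O w - p) ^+ 2 by have := estimate_le4 w; rewrite /g; lra.
    have php2 : (eta / 16 * p) ^+ 2 <= (phat mo O w - p) ^+ 2.
      rewrite -[leRHS]real_normK ?num_real // lerXn2r ?nnegrE ?(ltW php) //.
      by rewrite mulr_ge0 // divr_ge0 // ltW.
    have CC : 0 <= C1 / p ^+ 2 by rewrite divr_ge0 ?sqr_ge0.
    apply: le_trans (ler_wpM2l CC php2).
    rewrite [leRHS](_ : _ = 4 + 8 * (eta / 16) ^+ 2); last by rewrite /C1; field; rewrite !gt_eqF.
    by rewrite lerDl mulr_ge0 ?sqr_ge0.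
  have [Xw|[i [j Xij]]] : (forall i j, `|X i j w| <= 1) \/ exists i j, 1 < `|X i j w|.
  - have [|nX] := pselect (exists i j, 1 < `|X i j w|); [by right | left => i j].
    by rewrite leNgt; apply/negP => Xij; apply: nX; exists i, j.
  - have [Fw|Fw] := leP (F w) (tau ^+ q); last first.
      suff : 4 <= 4 / tau ^+ q * F w by have := estimate_le4 w; rewrite /g; lra.
      by rewrite -mulrA ler_peMr // mulrC ler_pdivlMr ?exprn_gt0 // mul1r ltW.
    have := usvt_loss_le eta01 n_gt0 p_gt0 (svdY w) psM M_le1 php (Fform w Xw Fw).
    rewrite -/sg -/C0 => /le_trans; apply; rewrite /g lerD2l.
    apply: ler_wpDr; first by rewrite addr_ge0.
    rewrite [leLHS]mulrA [leLHS]mulrAC ler_wpM2r ?sqr_ge0 //.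
    by rewrite ler_wpM2r ?invr_ge0 ?sqr_ge0 // lerDl sqr_ge0.
  - suff : 4 <= 4 * L w by have := estimate_le4 w; rewrite /g; lra.
  rewrite ler_peMr // /L (bigD1 i) //= (bigD1 j) //= indicE mem_set //= -addrA.
  rewrite lerDl addr_ge0 //; apply: sumr_ge0 => k _; rewrite ?indicE //.
  by apply: sumr_ge0 => k' _; rewrite indicE.
apply: (le_trans (expectation_le_bmeas P bg lossg)); rewrite lee_fin.
rewrite /g (ExD P (bmeas_cst _ _) (bmeasD b1 (bmeasD b2 b3))) (ExD P b1 (bmeasD b2 b3)).
rewrite (ExD P b2 b3) Ex_cst !ExZ //.
have -> : Ex P L = 0.
  rewrite /L Ex_sum => [|i _]; last by apply: bmeas_sum => j _; exact: bmeas_indic.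
  apply: big1 => i _; rewrite Ex_sum => [|j _]; last exact: bmeas_indic.
  by apply: big1 => j _; exact: Ex_large_data.
rewrite mulr0 addr0 -addrA lerD2l lerD //.
  (* Either model has at least n free entries, so the variance is at most p / n and the term becomes
     C1 / (np). *)
  have FE0 : (0 < #|free_entries mo n|)%N by exact: leq_trans card_free_entries.
  have := Ex_sqr_phat model_XO FE0.
  have : p / #|free_entries mo n|%:R <= p / n%:R.
    by rewrite ler_wpM2l // lef_pV2 ?posrE ?ltr0n // ler_nat card_free_entries.
  move=> h1 /le_trans/(_ h1) h2.
  rewrite (le_trans (ler_wpM2l _ h2)) ?divr_ge0 ?sqr_ge0 //.
  rewrite le_eqVlt; apply/orP; left; apply/eqP; field.
  by rewrite !gt_eqF.
rewrite (le_trans (ler_wpM2l _ EF)) ?divr_ge0 ?exprn_ge0 ?(ltW tau0) //.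
rewrite expr_div_n natrM le_eqVlt; apply/orP; left; apply/eqP; field.
by rewrite gt_eqF ?exprn_gt0.
Qed.

End Risk.

Theorem theorem2p8 (R : realType) (eta : R) (eta_gt0 : 0 < eta)
    (eta_lt1 : eta < 1) :
  exists C c : R, 0 < C /\ 0 < c /\
    forall eps : R, 0 < eps ->
    exists Ceps : R,
    forall (n : nat) (M : 'M[R]_n) (p : R),
      (0 < n)%N ->
      psdmx M ->
      (forall i j, `|M i j| <= 1) ->
      0 <= p <= 1 ->
      n%:R `^ (-1 + eps) <= p ->
    forall (d : measure_display) (T : measurableType d) (P : probability T R)
      (mo : model)
      (X : 'I_n -> 'I_n -> {RV P >-> R})
      (O : 'I_n -> 'I_n -> {RV P >-> bool}),
      data_model mo M p X O ->
    forall (s : T -> 'I_n -> R) (U V : T -> 'M[R]_n),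
      (forall w, is_svd (observed_mx X O w) (s w) (U w) (V w)) ->
      (MSE P M (fun w => usvt eta (phat mo O w) (s w) (U w) (V w))
        <= (C / Num.sqrt (n%:R * p) + Ceps * expR (- (c * n%:R * p)))%:E)%E.
Proof.
have eta01 : 0 < eta < 1 by rewrite eta_gt0.
set C0 := 64 * (2 + 10 / eta); set C1 := 8 + (32 / eta) ^+ 2.
have C0_ge0 : 0 <= C0.
  by rewrite mulr_ge0 ?ler0n // addr_ge0 ?ler0n // divr_ge0 ?ler0n // ltW.
have C1_ge0 : 0 <= C1.
  by apply: addr_ge0; [exact: ler0n | exact: sqr_ge0].
have C_gt0 : 0 < C0 + C1 + 8.
  by apply: ltr_wpDl; [exact: addr_ge0 | rewrite ltr0n].
(* One summand per term of [MSE_le_trace]: C1 / (np) <= C1 / sqrt(np) as np >= 1, and 8 n n^-2 <= 8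
   / sqrt(np) as np <= n^2. *)
exists (C0 + C1 + 8), 1; split=> //; split=> // eps eps0.
(* With kappa = eta / 4, the choice of q makes 3 q theta <= (eta / 4) theta^2, so the ratio in the
   trace term is at most [rho]. *)
pose rho := (2 + eta / 4) / (2 + eta / 2).
have den0 : 0 < 2 + eta / 2 by rewrite addr_gt0 ?divr_gt0.
have rho01 : 0 < rho < 1.
  rewrite divr_gt0 ?addr_gt0 ?divr_gt0 //= ltr_pdivrMr // mul1r; lra.
have kappa0 : 0 < eta / 4 by rewrite divr_gt0.
have [n0 n0P] := moment_choice rho01 kappa0 eps0.
(* For n < n0 one has np <= n0, so the exponential term alone is at least the trivial bound 4. *)
exists (4 * expR n0%:R) => n M p n_gt0 psM M1 p01 pn d T P mo X O mXO s U V svdY.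
have /andP[p0 p1] := p01.
have nR1 : 1 <= n%:R :> R by rewrite ler1n.
have nR0 : 0 < n%:R :> R by rewrite ltr0n.
have [nn0|nn0] := leqP n0 n; last first.
  apply: (le_trans (MSE_le4 eta mo O s U V n_gt0 M1)); rewrite lee_fin.
  apply: ler_wpDl; first by rewrite divr_ge0 ?sqrtr_ge0 ?(ltW C_gt0).
  rewrite -mulrA -expRD ler_peMr // -[leLHS]expR0 ler_expR mul1r subr_ge0.
  by rewrite (@le_trans _ _ n%:R) ?ler_piMr // ler_nat ltnW.
(* The hypothesis on p gives np >= n^eps. *)
have np1 : 1 <= n%:R * p.
  apply: (@le_trans _ _ (n%:R * n%:R `^ (-1 + eps))); last by rewrite ler_pM2l.
  rewrite -{1}(powRr1 (ltW nR0)) -powRD ?(gt_eqF nR0) ?implybT // addrA subrr add0r.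
  rewrite [leLHS](_ : _ = 1 `^ eps); last by rewrite powR1.
  by apply: ge0_ler_powR; rewrite ?nnegrE ?(ltW eps0) ?(ltW nR0).
have [r [qle rhoq]] := n0P _ _ nn0 n_gt0 pn.
apply: (le_trans (MSE_le_trace eta01 n_gt0 psM M1 p01 mXO svdY np1 r)).
rewrite lee_fin -[leLHS]addr0; apply: lerD; last by rewrite !mulr_ge0 ?expR_ge0.
set sg := Num.sqrt (n%:R * p) in qle *; set theta := Num.sqrt sg in qle *.
have sg1 : 1 <= sg by rewrite -[1]sqrtr1 ler_wsqrtr.
have sg0 : 0 < sg by exact: lt_le_trans sg1.
have sg2 : sg ^+ 2 = n%:R * p by rewrite sqr_sqrtr // mulr_ge0 // ltW.
have th2 : theta ^+ 2 = sg by rewrite sqr_sqrtr // ltW.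
have th0 : 0 <= theta by exact: sqrtr_ge0.
rewrite [leRHS]mulrDl [in leRHS]mulrDl; apply: lerD; first apply: lerD => //.
  by rewrite -sg2 ler_wpM2l // lef_pV2 ?posrE ?exprn_gt0 // expr2 ler_peMl // ltW.
have ratio : (2 * theta ^+ 2 + 3 * (2 ^ r.+1)%:R * theta) / ((2 + eta / 2) * sg) <= rho.
  rewrite ler_pdivrMr ?mulr_gt0 // /rho [leRHS]mulrA divfK ?gt_eqF //.
  by rewrite [leRHS]mulrDl th2 lerD2l -th2 expr2 mulrA ler_wpM2r.
have ratio0 : 0 <= (2 * theta ^+ 2 + 3 * (2 ^ r.+1)%:R * theta) / ((2 + eta / 2) * sg).
  by rewrite divr_ge0 ?addr_ge0 ?mulr_ge0 ?exprn_ge0 ?(ltW sg0) ?(ltW den0).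
have rho_ge0 : 0 <= rho by case/andP: rho01 => /ltW.
have rate := le_trans (lerXn2r (2 ^ r.+1) ratio0 rho_ge0 ratio) rhoq.
rewrite (le_trans (ler_wpM2l _ rate)) ?mulr_ge0 //.
rewrite -mulrA ler_wpM2l // expr2 invfM mulrA divff ?gt_eqF // mul1r.
rewrite lef_pV2 ?posrE // -ler_sqr ?nnegrE ?(ltW sg0) ?(ltW nR0) // sg2 expr2.
by rewrite ler_wpM2l ?(ltW nR0) // (le_trans p1).
Qed.
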